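(* Let $X$ be a ball Banach function space on $\mathbb R^n$. Then a subset $\mathcal F$ of $X$ is totally bounded if $\mathcal F$ satisfies the following three conditions: (i) $\mathcal F$ is bounded, namely, $\sup_{f\in\mathcal F}\|f\|_X<\infty$; (ii) $\mathcal F$ uniformly vanishes at infinity, namely, for any given $\epsilon\in(0,\infty)$, there exists a positive constant $M$ such that, for any $f\in\mathcal F$, $\|f\mathbf 1_{\{x\in\mathbb R^n:|x|>M\}}\|_X<\epsilon$; (iii) $\mathcal F$ is uniformly equicontinuous, namely, for any given $\epsilon\in(0,\infty)$, there exists a positive constant $\rho$ such that, for any $f\in\mathcal F$ and $\xi\in\mathbb R^n$ with $|\xi|\in[0,\rho)$, $\|f(\cdot+\xi)-f(\cdot)\|_X<\epsilon$. Conversely, assume in addition that $C_{\rm c}(\mathbb R^n)$ is dense in $X$ and that, for any $f\in X$ and $y\in\mathbb R^n$, $\|f\|_X=\|f(\cdot+y)\|_X$. If a subset $\mathcal F$ of $X$ is totally bounded, then $\mathcal F$ satisfies (i), (ii) and (iii).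
   Context: Ball Banach function space: let $\mathscr M(\mathbb R^n)$ be the set of all measurable functions on $\mathbb R^n$. A Banach space $X\subset\mathscr M(\mathbb R^n)$ (with $\|f\|_X=\infty$ for $f\notin X$) is a ball Banach function space if: $\|f\|_X=0$ implies $f=0$ a.e.; $|g|\le|f|$ a.e. implies $\|g\|_X\le\|f\|_X$; $0\le f_m\uparrow f$ a.e. implies $\|f_m\|_X\uparrow\|f\|_X$; $\mathbf 1_B\in X$ for every ball $B$; $\|f+g\|_X\le\|f\|_X+\|g\|_X$; and for every ball $B$ there is $C_{(B)}>0$ with $\int_B|f|\,dx\le C_{(B)}\|f\|_X$ for all $f\in X$. $C_{\rm c}(\mathbb R^n)$ is the set of continuous functions with compact support. A set $\mathcal F\subset X$ is totally bounded if for any $\epsilon\in(0,\infty)$ there is a finite $\epsilon$-net, i.e. a finite set $\mathcal G\subset\mathcal F$ such that for any $f\in\mathcal F$ there is $g\in\mathcal G$ with $\|f-g\|_X<\epsilon$. *)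

(* Defs.v *)
From HB Require Import structures.
From mathcomp Require Import all_boot all_order all_algebra.
From mathcomp Require Import all_classical all_reals all_analysis.

Set Implicit Arguments.
Unset Strict Implicit.
Unset Printing Implicit Defensive.

Import Order.TTheory GRing.Theory Num.Theory.
Import numFieldNormedType.Exports.

Local Open Scope classical_set_scope.
Local Open Scope ring_scope.

(* Lebesgue measure on R^n is obtained as the n-fold product of the
   one-dimensional Lebesgue measure on n.-tuple R, transported to the normed
   space 'rV[R]_n and then completed (Caratheodory extension), so that
   measurability below means Lebesgue measurability. *)

Section lebesgue_tuple.
Context {R : realType}.
Notation tupR n := (n.-tuple (measurableTypeR R)).

Definition cons_tuple_of_pair n (p : measurableTypeR R * tupR n) : tupR n.+1 :=
  [the tupR n.+1 of p.1 :: p.2].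

Definition pair_of_cons_tuple n (t : tupR n.+1) : measurableTypeR R * tupR n :=
  (tnth t ord0, [tuple of behead t]).

Lemma cons_tuple_of_pairK n :
  cancel (@cons_tuple_of_pair n) (@pair_of_cons_tuple n).
Proof. by case=> x t; congr pair; apply/val_inj. Qed.

Lemma pair_of_cons_tupleK n :
  cancel (@pair_of_cons_tuple n) (@cons_tuple_of_pair n).
Proof. by move=> t; rewrite [RHS]tuple_eta; exact/val_inj. Qed.

Lemma measurable_cons_tuple_of_pair n :
  measurable_fun [set: measurableTypeR R * tupR n] (@cons_tuple_of_pair n).
Proof. exact: (measurable_cons measurable_fst measurable_snd). Qed.

Lemma measurable_pair_of_cons_tuple n :
  measurable_fun [set: tupR n.+1] (@pair_of_cons_tuple n).
Proof.
by apply/measurable_fun_pair => /=;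
  [exact: measurable_tnth | exact: measurable_behead].
Qed.

Section step.
Context (n : nat) (m : {sigma_finite_measure set (tupR n) -> \bar R}).

Definition lebesgue_tupleS : set (tupR n.+1) -> \bar R :=
  pushforward (@lebesgue_measure R \x m)%E (@cons_tuple_of_pair n).

Let mpre A : measurable A -> measurable (@cons_tuple_of_pair n @^-1` A).
Proof.
by move=> mA; rewrite -[X in measurable X]setTI;
  exact: measurable_cons_tuple_of_pair.
Qed.

Let lebesgue_tupleS0 : lebesgue_tupleS set0 = 0%E.
Proof. by rewrite /lebesgue_tupleS /pushforward preimage_set0 measure0. Qed.

Let lebesgue_tupleS_ge0 A : (0 <= lebesgue_tupleS A)%E.
Proof. by rewrite /lebesgue_tupleS /pushforward. Qed.

Let lebesgue_tupleS_sigma_additive : semi_sigma_additive lebesgue_tupleS.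
Proof.
move=> F mF tF mUF; rewrite /lebesgue_tupleS /pushforward preimage_bigcup.
apply: measure_semi_sigma_additive.
- by move=> k; exact: mpre.
- apply/trivIsetP => /= i j _ _ ij; rewrite -preimage_setI.
  by move/trivIsetP : tF => /(_ _ _ _ _ ij) ->//; rewrite preimage_set0.
- by rewrite -preimage_bigcup; exact: mpre.
Qed.

HB.instance Definition _ := isMeasure.Build _ _ _ lebesgue_tupleS
  lebesgue_tupleS0 lebesgue_tupleS_ge0 lebesgue_tupleS_sigma_additive.

Let lebesgue_tupleS_sigma_finite : sigma_finite setT lebesgue_tupleS.
Proof.
have /sigma_finiteP[F [FT ndF Foo]] := sigma_finiteT (@lebesgue_measure R).
have /sigma_finiteP[G [GT ndG Goo]] := sigma_finiteT m.
exists (fun k => @pair_of_cons_tuple n @^-1` (F k `*` G k)).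
  rewrite -preimage_bigcup; apply/esym; rewrite -subTset => t _ /=.
  have [i _ Fi] : (\bigcup_k F k) (tnth t ord0) by rewrite -FT.
  have [j _ Gj] : (\bigcup_k G k) [tuple of behead t] by rewrite -GT.
  exists (maxn i j) => //; split => /=.
    by move: Fi; exact/subsetPset/ndF/leq_maxl.
  by move: Gj; exact/subsetPset/ndG/leq_maxr.
move=> k; have [mF Fk] := Foo k; have [mG Gk] := Goo k; split.
  rewrite -[X in measurable X]setTI.
  by apply: measurable_pair_of_cons_tuple => //; exact: measurableX.
rewrite /lebesgue_tupleS /pushforward -comp_preimage.
rewrite (_ : _ \o _ = id); last first.
  by apply/funext => p /=; rewrite cons_tuple_of_pairK.
by rewrite preimage_id product_measure1E// lte_mul_pinfty// ge0_fin_numE.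
Qed.

HB.instance Definition _ := Measure_isSigmaFinite.Build _ _ _ lebesgue_tupleS
  lebesgue_tupleS_sigma_finite.

End step.

Fixpoint lebesgue_tuple n : {sigma_finite_measure set (tupR n) -> \bar R} :=
  match n with
  | 0 => \d_([tuple] : tupR 0)
  | n'.+1 => lebesgue_tupleS (lebesgue_tuple n')
  end.

End lebesgue_tuple.

Section lebesgue_rV.
Context {R : realType} (n : nat).
Notation tupR := (n.-tuple (measurableTypeR R)).

Definition tuple_of_rV (x : 'rV[R]_n) : tupR := [tuple x ord0 i | i < n].

(* 'rV[R]_n with the product (Borel) sigma-algebra *)
Definition borel_rV := g_sigma_algebra_preimageType tuple_of_rV.

Definition rV_of_tuple (t : tupR) : borel_rV := \row_i tnth t i.

Definition lebesgue_borel_rV : set borel_rV -> \bar R :=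
  pushforward (lebesgue_tuple n) rV_of_tuple.

Lemma rV_of_tupleK : cancel rV_of_tuple tuple_of_rV.
Proof.
by move=> t; apply: eq_from_tnth => i; rewrite tnth_mktuple mxE.
Qed.

Lemma tuple_of_rVK : cancel tuple_of_rV rV_of_tuple.
Proof. by move=> x; apply/rowP => i; rewrite mxE tnth_mktuple. Qed.

Let mpre (A : set borel_rV) : measurable A -> measurable (rV_of_tuple @^-1` A).
Proof.
move=> [B mB <-]; rewrite setTI -comp_preimage.
rewrite (_ : _ \o _ = id) ?preimage_id//.
by apply/funext => p /=; rewrite rV_of_tupleK.
Qed.

Let lebesgue_borel_rV0 : lebesgue_borel_rV set0 = 0%E.
Proof. by rewrite /lebesgue_borel_rV /pushforward preimage_set0 measure0. Qed.

Let lebesgue_borel_rV_ge0 A : (0 <= lebesgue_borel_rV A)%E.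
Proof. by rewrite /lebesgue_borel_rV /pushforward. Qed.

Let lebesgue_borel_rV_sigma_additive : semi_sigma_additive lebesgue_borel_rV.
Proof.
move=> F mF tF mUF; rewrite /lebesgue_borel_rV /pushforward preimage_bigcup.
apply: measure_semi_sigma_additive.
- by move=> k; exact: mpre.
- apply/trivIsetP => /= i j _ _ ij; rewrite -preimage_setI.
  by move/trivIsetP : tF => /(_ _ _ _ _ ij) ->//; rewrite preimage_set0.
- by rewrite -preimage_bigcup; exact: mpre.
Qed.

HB.instance Definition _ := isMeasure.Build _ _ _ lebesgue_borel_rV
  lebesgue_borel_rV0 lebesgue_borel_rV_ge0 lebesgue_borel_rV_sigma_additive.

(* 'rV[R]_n with the sigma-algebra of Lebesgue measurable sets *)
Definition lebesgue_rVType := caratheodory_type (lebesgue_borel_rV^*)%mu.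

Definition lebesgue_rV : {measure set lebesgue_rVType -> \bar R} :=
  @completed_measure_extension _ _ _ lebesgue_borel_rV.

End lebesgue_rV.
Arguments borel_rV : clear implicits.
Arguments lebesgue_rVType : clear implicits.
Arguments lebesgue_rV : clear implicits.

Section euclidean_space.
Context {R : realType} {n : nat}.

(* The norm `|x| of 'rV[R]_n is the maximum norm. *)
Definition euclidean_norm (x : 'rV[R]_n) : R :=
  Num.sqrt (\sum_(i < n) x ord0 i ^+ 2).

Definition euclidean_ball (x : 'rV[R]_n) (r : R) : set 'rV[R]_n :=
  [set y | euclidean_norm (y - x) < r].

Definition lebesgue_measurable_fun (f : 'rV[R]_n -> R) : Prop :=
  measurable_fun [set: lebesgue_rVType R n] (f : lebesgue_rVType R n -> R).

Definition translate (f : 'rV[R]_n -> R) (xi : 'rV[R]_n) : 'rV[R]_n -> R :=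
  fun x => f (x + xi).

Definition continuous_compact_support : set ('rV[R]_n -> R) :=
  [set f | continuous f /\ compact (closure [set x | f x != 0])].

End euclidean_space.

(* X is a set of functions rather than of classes modulo a.e. equality: by
   bbfs_lattice, the norm and membership in X only depend on the class. The
   norm is defined on all functions, with value +oo off X. *)
Record ballBanachFunctionSpace (R : realType) (n : nat) :=
    BallBanachFunctionSpace {
  bbfs_space : set ('rV[R]_n -> R);
  bbfs_norm : ('rV[R]_n -> R) -> \bar R;
  bbfs_measurable : forall f, bbfs_space f -> lebesgue_measurable_fun f;
  bbfs_space0 : bbfs_space (cst 0);
  bbfs_spaceD : forall f g, bbfs_space f -> bbfs_space g -> bbfs_space (f \+ g);
  bbfs_spaceZ : forall (a : R) f, bbfs_space f -> bbfs_space (a \*o f);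
  bbfs_norm_ge0 : forall f, (0 <= bbfs_norm f)%E;
  bbfs_norm_fin : forall f, bbfs_space f -> (bbfs_norm f < +oo)%E;
  bbfs_norm_out : forall f, ~ bbfs_space f -> bbfs_norm f = +oo%E;
  bbfs_normZ : forall (a : R) f, bbfs_space f ->
    bbfs_norm (a \*o f) = (`|a|%:E * bbfs_norm f)%E;
  bbfs_complete : forall u : nat -> 'rV[R]_n -> R,
    (forall k, bbfs_space (u k)) ->
    (forall e : R, 0 < e -> exists N, forall k l, (N <= k)%N -> (N <= l)%N ->
       (bbfs_norm (u k \- u l)%R < e%:E)%E) ->
    exists2 f, bbfs_space f & bbfs_norm (u k \- f) @[k --> \oo] --> 0%E;
  bbfs_norm_eq0 : forall f, lebesgue_measurable_fun f -> bbfs_norm f = 0%E ->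
    {ae lebesgue_rV R n, forall x, f x = 0};
  bbfs_lattice : forall f g,
    lebesgue_measurable_fun f -> lebesgue_measurable_fun g ->
    {ae lebesgue_rV R n, forall x, `|g x| <= `|f x|} ->
    (bbfs_norm g <= bbfs_norm f)%E;
  bbfs_fatou : forall (u : nat -> 'rV[R]_n -> R) f,
    (forall k, lebesgue_measurable_fun (u k)) -> lebesgue_measurable_fun f ->
    {ae lebesgue_rV R n, forall x, [/\ forall k, 0 <= u k x,
       nondecreasing_seq (u ^~ x) & u k x @[k --> \oo] --> f x]} ->
    nondecreasing_seq (bbfs_norm \o u) /\
    (bbfs_norm (u k) @[k --> \oo] --> bbfs_norm f);
  bbfs_ball : forall x (r : R), 0 < r -> bbfs_space (\1_(euclidean_ball x r));
  bbfs_normD : forall f g,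
    lebesgue_measurable_fun f -> lebesgue_measurable_fun g ->
    (bbfs_norm (f \+ g)%R <= bbfs_norm f + bbfs_norm g)%E;
  bbfs_integral : forall x (r : R), 0 < r -> exists2 C : R, 0 < C &
    forall f, bbfs_space f ->
      (\int[lebesgue_rV R n]_(y in euclidean_ball x r) `|f y|%:E
        <= C%:E * bbfs_norm f)%E
}.

Section compactness_conditions.
Context {R : realType} {n : nat}.
Variable X : ballBanachFunctionSpace R n.
Implicit Type F : set ('rV[R]_n -> R).

Definition bbfs_totally_bounded F : Prop :=
  forall e : R, 0 < e -> exists G : set ('rV[R]_n -> R),
    [/\ finite_set G, G `<=` F &
      forall f, F f -> exists2 g, G g & (bbfs_norm X (f \- g)%R < e%:E)%E].

Definition bbfs_bounded F : Prop :=
  (ereal_sup [set bbfs_norm X f | f in F] < +oo)%E.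

Definition uniformly_vanishes_at_infinity F : Prop :=
  forall e : R, 0 < e -> exists2 M : R, 0 < M & forall f, F f ->
    (bbfs_norm X (f \* \1_[set x | M < euclidean_norm x])%R < e%:E)%E.

Definition uniformly_equicontinuous F : Prop :=
  forall e : R, 0 < e -> exists2 rho : R, 0 < rho &
    forall f (xi : 'rV[R]_n), F f -> euclidean_norm xi < rho ->
      (bbfs_norm X (translate f xi \- f)%R < e%:E)%E.

Definition bbfs_dense (D : set ('rV[R]_n -> R)) : Prop :=
  D `<=` bbfs_space X /\
  forall f, bbfs_space X f -> forall e : R, 0 < e ->
    exists2 g, D g & (bbfs_norm X (f \- g)%R < e%:E)%E.

Definition translation_invariant : Prop :=
  forall f (y : 'rV[R]_n), bbfs_space X f ->
    bbfs_norm X f = bbfs_norm X (translate f y).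

End compactness_conditions.

(* Main.v *)
Require Import Defs.
From HB Require Import structures.
From mathcomp Require Import all_boot all_order all_algebra.
From mathcomp Require Import all_classical all_reals all_analysis.
From mathcomp Require Import measurable_realfun ring lra zify.

(* Sufficiency. Cut a large cube into finitely many half-open cubes [Q] of side
   [d] and replace [f] on each [Q] by its mean. The image is finite
   dimensional and, by (i), bounded there, so everything reduces to bounding
   the norm of [f] minus its means. For that, [f] is compared with
   [N^-n * sum_j (f 1_Q)(x + j d/N)], [j] ranging over [{-N,...,N-1}^n]: the
   triangle inequality and (iii) bound the norm of the difference by [2^n e],
   and as [N] grows these averages converge to the mean of [f] in [L^1(Q)],
   hence a.e. along a subsequence, so that the Fatou property of [X] applies.
   This avoids Minkowski's integral inequality (and the associate space).
   Convergence in [L^1(Q)] holds for orthants by counting, and passes to all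
   integrable functions because the averaging operators are uniformly bounded
   on [L^1(Q)] by translation invariance of Lebesgue measure.

   Necessity. For a function in [C_c], conditions (ii) and (iii) follow from
   compactness of the support and uniform continuity; density and translation
   invariance transfer them to each element of a finite net, and then to
   [F]. *)

Set Implicit Arguments.
Unset Strict Implicit.
Unset Printing Implicit Defensive.

Import Order.TTheory GRing.Theory Num.Theory.
Import numFieldNormedType.Exports HBSimple.

Local Open Scope classical_set_scope.
Local Open Scope ring_scope.

(** * Translation invariance of Lebesgue measure on R^n *)

Section pushforward_translation.
Context d {T : measurableType d} {R : realType}.
Variables (mu : {measure set T -> \bar R}) (phi : T -> T).
Hypothesis mphi : measurable_fun setT phi.
Hypothesis muphi : forall A, measurable A -> mu (phi @^-1` A) = mu A.

Lemma ge0_integral_invariant (f : T -> \bar R) :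
  measurable_fun [set: _] f -> (forall x, 0 <= f x)%E ->
  (\int[mu]_x f (phi x) = \int[mu]_x f x)%E.
Proof.
move=> mf f0.
rewrite (_ : (\int[mu]_x f (phi x))%E = (\int[mu]_(x in phi @^-1` setT) (f \o phi) x)%E) //.
rewrite -(ge0_integral_pushforward mphi)//.
by apply: eq_measure_integral => A mA _; exact: muphi.
Qed.

End pushforward_translation.

Section translation_invariance.
Context {R : realType}.

Lemma measurable_shift (t : R) :
  measurable_fun setT (fun x : measurableTypeR R => x + t : measurableTypeR R).
Proof. by apply: measurable_funD. Qed.

(** Lebesgue measure on the line is determined by its values on half-open intervals, and a shift
    preserves their length. *)
Lemma lebesgue_measure_shift (t : R) (A : set (measurableTypeR R)) :
  measurable A -> lebesgue_measure ((fun x : R => x + t) @^-1` A) = lebesgue_measure A.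
Proof.
move=> mA.
pose f_mixin := isMeasurableFun.Build _ _ _ _ _ (measurable_shift t).
pose f : {mfun measurableTypeR R >-> measurableTypeR R} :=
  HB.pack (fun x : measurableTypeR R => x + t : measurableTypeR R) f_mixin.
rewrite [RHS](lebesgue_measure_unique (mu := pushforward lebesgue_measure f)) //.
move=> _ [[a b] /= _ <-]; rewrite /pushforward.
rewrite (_ : _ @^-1` _ = `]a - t, b - t]%classic); last first.
  by apply/seteqP; split=> x /=; rewrite !in_itv /= ltrBlDr lerBrDr.
rewrite !lebesgue_measure_itv /= !lte_fin ltrD2r.
case: ifP => // _; rewrite -!EFinB; congr EFin.
by rewrite opprB addrA subrK.
Qed.

Notation tupR n := (n.-tuple (measurableTypeR R)).

Definition shift_tuple n (t : 'I_n -> R) (u : tupR n) : tupR n :=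
  [tuple tnth u i + t i | i < n].

Lemma measurable_shift_tuple n (t : 'I_n -> R) :
  measurable_fun setT (shift_tuple t).
Proof.
apply/measurable_fun_tnthP => i.
rewrite (_ : _ \o _ = fun u : tupR n => tnth u i + t i); last first.
  by apply/funext => u /=; rewrite tnth_mktuple.
apply: measurable_funD => //; exact: measurable_tnth.
Qed.

(** Induction on the dimension: the shift acts separately on the head and the tail, so the
    pushforward agrees with the product measure on rectangles, and the product measure is unique. *)
Lemma lebesgue_tuple_shift n (t : 'I_n -> R) (A : set (tupR n)) :
  measurable A -> lebesgue_tuple n (shift_tuple t @^-1` A) = lebesgue_tuple n A.
Proof.
elim: n t A => [|n IH] t A mA.
  congr (lebesgue_tuple 0 _); apply/seteqP.
  by split => u /=; rewrite (tuple0 (shift_tuple t u)) (tuple0 u).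
pose s (p : measurableTypeR R * tupR n) : measurableTypeR R * tupR n :=
  (p.1 + t ord0, shift_tuple (t \o lift ord0) p.2).
have ms : measurable_fun setT s.
  apply/measurable_fun_pair => /=.
    by apply: measurable_funD.
  exact: (measurableT_comp (measurable_shift_tuple _) measurable_snd).
pose s_mixin := isMeasurableFun.Build _ _ _ _ _ ms.
pose sm : {mfun _ >-> _} := HB.pack s s_mixin.
have mB : measurable (@cons_tuple_of_pair R n @^-1` A).
  by rewrite -[X in measurable X]setTI; exact: measurable_cons_tuple_of_pair.
rewrite /= /lebesgue_tupleS /pushforward.
rewrite [RHS](product_measure_unique
  (m' := pushforward (lebesgue_measure \x lebesgue_tuple n)%E sm)) //.
  rewrite /pushforward; congr (product_measure1 _ _ _).
  suff E p : shift_tuple t (cons_tuple_of_pair p) = cons_tuple_of_pair (s p).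
    by apply/seteqP; split=> p; rewrite /preimage/= E.
  case: p => x u; apply: eq_from_tnth => i.
  rewrite tnth_mktuple; case: (unliftP ord0 i) => [j|] ->.
    by rewrite !tnthS tnth_mktuple.
  by rewrite !tnth0.
move=> B C mB' mC; rewrite /pushforward.
transitivity ((lebesgue_measure \x lebesgue_tuple n)%E
  (((fun x : R => x + t ord0) @^-1` B) `*` (shift_tuple (t \o lift ord0) @^-1` C))) => //.
rewrite product_measure1E.
- by congr (_ * _)%E; [exact: lebesgue_measure_shift|exact: IH].
- by rewrite -[X in measurable X]setTI; exact: measurable_shift.
- by rewrite -[X in measurable X]setTI; exact: measurable_shift_tuple.
Qed.

Variable n : nat.
Implicit Types xi : 'rV[R]_n.

Lemma tuple_of_rV_shift xi (x : 'rV[R]_n) :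
  tuple_of_rV (x + xi) = shift_tuple (xi ord0) (tuple_of_rV x).
Proof. by apply: eq_from_tnth => i; rewrite !tnth_mktuple mxE. Qed.

Lemma measurable_borel_shift xi (A : set (borel_rV R n)) :
  measurable A -> measurable ((fun x : borel_rV R n => x + xi : borel_rV R n) @^-1` A).
Proof.
move=> [B mB <-]; exists (shift_tuple (xi ord0) @^-1` B).
  by rewrite -[X in measurable X]setTI; exact: measurable_shift_tuple.
by rewrite !setTI; apply/seteqP; split=> x; rewrite /preimage/= tuple_of_rV_shift.
Qed.

Lemma lebesgue_borel_rVE (B : set (n.-tuple (measurableTypeR R))) :
  lebesgue_borel_rV (tuple_of_rV (n:=n) @^-1` B) = lebesgue_tuple n B.
Proof.
by congr (lebesgue_tuple n _); apply/seteqP; split=> u; rewrite /preimage/= rV_of_tupleK.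
Qed.

Lemma lebesgue_borel_rV_shift xi (A : set (borel_rV R n)) : measurable A ->
  lebesgue_borel_rV ((fun x : borel_rV R n => x + xi : borel_rV R n) @^-1` A) =
  lebesgue_borel_rV A.
Proof.
move=> [B mB <-]; rewrite setTI lebesgue_borel_rVE -(lebesgue_tuple_shift (xi ord0))//.
rewrite -lebesgue_borel_rVE; congr lebesgue_borel_rV.
by apply/seteqP; split=> x; rewrite /preimage/= tuple_of_rV_shift.
Qed.

Local Notation lam := ((@lebesgue_borel_rV R n)^*)%mu.

(** A Borel cover of [A] is translated to a cover with the same total measure. Applying this to the
    opposite shift as well turns the inequality into an equality. *)
Let outer_shift_le xi (A : set 'rV[R]_n) :
  (lam ((fun x => x + xi)%R @^-1` A) <= lam A)%E.
Proof.
apply/le_ereal_inf_tmp => _ [B [mB AB] <-].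
apply: ereal_inf_lbound.
exists (fun k => (fun x : borel_rV R n => x + xi : borel_rV R n) @^-1` B k).
  split; first by move=> k; exact: measurable_borel_shift.
  by rewrite -preimage_bigcup; exact: preimage_subset.
by apply: eq_eseriesr => k _; exact: lebesgue_borel_rV_shift.
Qed.

Lemma outer_lebesgue_shift xi (A : set 'rV[R]_n) :
  lam ((fun x => x + xi) @^-1` A) = lam A.
Proof.
apply/eqP; rewrite eq_le outer_shift_le /=.
have {1}-> : A = (fun x => x - xi) @^-1` ((fun x => x + xi) @^-1` A).
  by apply/seteqP; split=> x; rewrite /preimage/= subrK.
exact: outer_shift_le.
Qed.

(** Lebesgue measurability is Caratheodory's criterion for the outer measure, so the criterion
    itself is transported, each test set [X] being replaced by its translate. *)
Lemma measurable_lebesgue_shift xi : measurable_fun setT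
  (fun x : lebesgue_rVType R n => x + xi : lebesgue_rVType R n).
Proof.
move=> _ A mA; rewrite setTI.
have cA (X : set 'rV[R]_n) : (lam X = lam (X `&` A) + lam (X `&` ~` A))%E by exact: mA.
suff cs (X : set 'rV[R]_n) : (lam X = lam (X `&` ((fun x => x + xi)%R @^-1` A)) +
    lam (X `&` ~` ((fun x => x + xi)%R @^-1` A)))%E by exact: cs.
have XE : X = (fun x => x + xi) @^-1` ((fun x => x - xi) @^-1` X).
  by apply/seteqP; split=> x; rewrite /preimage/= addrK.
rewrite XE outer_lebesgue_shift cA; congr (_ + _)%E.
  by rewrite -[LHS](outer_lebesgue_shift xi).
by rewrite -[LHS](outer_lebesgue_shift xi).
Qed.

Lemma lebesgue_rV_shift xi (A : set (lebesgue_rVType R n)) :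
  lebesgue_rV R n ((fun x : lebesgue_rVType R n => x + xi : lebesgue_rVType R n) @^-1` A) =
  lebesgue_rV R n A.
Proof. exact: outer_lebesgue_shift. Qed.

Lemma ge0_integral_shift xi (f : lebesgue_rVType R n -> \bar R) :
  measurable_fun [set: _] f -> (forall x, 0 <= f x)%E ->
  (\int[lebesgue_rV R n]_x f ((x : 'rV[R]_n) + xi)%R =
   \int[lebesgue_rV R n]_x f x)%E.
Proof.
move=> mf f0.
apply: (ge0_integral_invariant (measurable_lebesgue_shift xi)) => //.
by move=> A _; exact: lebesgue_rV_shift.
Qed.

Lemma measurable_translate xi (f : 'rV[R]_n -> R) :
  lebesgue_measurable_fun f -> lebesgue_measurable_fun (translate f xi).
Proof. by move=> mf; apply: (measurableT_comp mf); exact: measurable_lebesgue_shift. Qed.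

End translation_invariance.

(** * L^1 seminorms over a measurable set *)

Lemma measurable_normr_EFin d (T : measurableType d) (R : realType) (D : set T)
    (f : T -> R) :
  measurable_fun [set: T] f -> measurable_fun D (fun x => `|f x|%:E).
Proof.
move=> mf; apply/measurable_EFinP; apply: measurableT_comp => //.
exact: measurable_funTS.
Qed.

Section l1_seminorm.
Context d {T : measurableType d} {R : realType}.
Variables (mu : {measure set T -> \bar R}) (D : set T).
Hypothesis mD : measurable D.
Implicit Types f g : T -> R.

Definition l1norm f : \bar R := (\int[mu]_(x in D) `|f x|%:E)%E.

Lemma l1norm_restrict f : l1norm f = (\int[mu]_x `|f x * \1_D x|%:E)%E.
Proof.
rewrite /l1norm integral_mkcond; apply: eq_integral => x _.
by rewrite patchE indicE; case: ifP; rewrite ?mulr1// mulr0 normr0.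
Qed.

Lemma l1norm_ge0 f : (0 <= l1norm f)%E.
Proof. by apply: integral_ge0 => x _; rewrite lee_fin. Qed.

Lemma le_l1norm f g : measurable_fun [set: T] f -> measurable_fun [set: T] g ->
  (forall x, D x -> `|f x| <= `|g x|) -> (l1norm f <= l1norm g)%E.
Proof.
move=> mf mg fg; apply: ge0_le_integral => //.
- exact: measurable_normr_EFin mf.
- exact: measurable_normr_EFin mg.
Qed.

Lemma l1normD f g : measurable_fun [set: T] f -> measurable_fun [set: T] g ->
  (l1norm (fun x => f x + g x)%R <= l1norm f + l1norm g)%E.
Proof.
move=> mf mg; rewrite /l1norm -ge0_integralD//; last 2 first.
  exact: measurable_normr_EFin mf.
  exact: measurable_normr_EFin mg.
apply: ge0_le_integral => //.
- exact: (measurable_normr_EFin (measurable_funD mf mg)).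
- by apply: emeasurable_funD; [exact: measurable_normr_EFin mf|exact: measurable_normr_EFin mg].
- by move=> x _; rewrite lee_fin ler_normD.
Qed.

Lemma l1normZ (a : R) f : measurable_fun [set: T] f ->
  (l1norm (fun x => a * f x)%R = `|a|%:E * l1norm f)%E.
Proof.
move=> mf; rewrite /l1norm -ge0_integralZl_EFin//; last exact: measurable_normr_EFin mf.
by apply: eq_integral => x _; rewrite normrM EFinM.
Qed.

Lemma l1normB f g : measurable_fun [set: T] f -> measurable_fun [set: T] g ->
  (l1norm (fun x => f x - g x)%R <= l1norm f + l1norm g)%E.
Proof.
move=> mf mg.
have -> : l1norm g = l1norm (fun x => - g x).
  by apply: eq_integral => x _; rewrite normrN.
by apply: l1normD => //; exact: measurableT_comp.
Qed.

Lemma l1norm_integrable f : measurable_fun [set: T] f -> (l1norm f < +oo)%E ->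
  mu.-integrable D (EFin \o f).
Proof.
move=> mf foo; apply/integrableP; split => //.
by apply/measurable_EFinP; exact: measurable_funTS.
Qed.

End l1_seminorm.

(** * Boxes and orthants, their measure and the sigma-algebra they generate *)

Section boxes.
Context {R : realType} {n : nat}.
Notation tupR n := (n.-tuple (measurableTypeR R)).
Implicit Types l u : 'I_n -> R.

Lemma measurable_tuple_rect m (A : 'I_m -> set (measurableTypeR R)) :
  (forall i, measurable (A i)) ->
  measurable [set t : tupR m | forall i, A i (tnth t i)].
Proof.
move=> mA.
rewrite (_ : mkset _ = \bigcap_(i in [set: 'I_m]) ((fun t : tupR m => tnth t i) @^-1` A i)).
  apply: fin_bigcap_measurable => // i _.
  by rewrite -[X in measurable X]setTI; exact: measurable_tnth.
by apply/seteqP; split=> [t /= At i _|t /= At i]; exact: At.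
Qed.

Lemma lebesgue_tuple_rect m (A : 'I_m -> set (measurableTypeR R)) :
  (forall i, measurable (A i)) ->
  lebesgue_tuple m [set t : tupR m | forall i, A i (tnth t i)] =
  (\prod_(i < m) lebesgue_measure (A i))%E.
Proof.
elim: m A => [|m IH] A mA.
  by rewrite big_ord0 /= diracE mem_set// => -[].
have mA' i : measurable ((A \o lift ord0) i) by exact: mA.
rewrite big_ord_recl -(IH _ mA').
rewrite -(@product_measure1E _ _ _ _ R lebesgue_measure (lebesgue_tuple m))//; last first.
  exact: measurable_tuple_rect mA'.
congr (product_measure1 _ _ _); apply/seteqP; split=> [[x t] /= At|[x t] /= [Ax At] i].
  split; first by have := At ord0; rewrite tnth0.
  by move=> i; have := At (lift ord0 i); rewrite tnthS.
by case: (unliftP ord0 i) => [j|] ->; rewrite ?tnthS ?tnth0//; exact: At.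
Qed.

Lemma borel_lebesgue_measurable (A : set (borel_rV R n)) :
  measurable A -> measurable (A : set (lebesgue_rVType R n)).
Proof. exact: caratheodory_measurable_mu_ext. Qed.

Lemma lebesgue_rV_borelE (A : set (borel_rV R n)) :
  measurable A -> lebesgue_rV R n A = lebesgue_borel_rV A.
Proof. exact: measurable_mu_extE. Qed.

(** Half-open, so that neighbouring cubes of a grid tile space without overlap. *)
Definition box l u : set 'rV[R]_n := [set x | forall i, l i <= x ord0 i < u i].

Lemma box_tuple l u :
  box l u = tuple_of_rV (n:=n) @^-1` [set t | forall i, `[l i, u i[%classic (tnth t i)].
Proof.
by apply/seteqP; split=> x /= H i; move: (H i); rewrite tnth_mktuple /= in_itv.
Qed.

Lemma measurable_box_borel l u : measurable (box l u : set (borel_rV R n)).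
Proof.
exists [set t : tupR n | forall i, `[l i, u i[%classic (tnth t i)].
  exact: (@measurable_tuple_rect n (fun i => `[l i, u i[%classic)).
by rewrite setTI box_tuple.
Qed.

Lemma measurable_box l u : measurable (box l u : set (lebesgue_rVType R n)).
Proof. by apply: borel_lebesgue_measurable; exact: measurable_box_borel. Qed.

Lemma lebesgue_rV_box l u : (forall i, l i <= u i) ->
  lebesgue_rV R n (box l u) = (\prod_(i < n) (u i - l i))%:E.
Proof.
move=> lu; rewrite lebesgue_rV_borelE; last exact: measurable_box_borel.
rewrite box_tuple lebesgue_borel_rVE.
rewrite (@lebesgue_tuple_rect n (fun i => `[l i, u i[%classic))//.
rewrite -prodEFin; apply: eq_bigr => i _; rewrite lebesgue_measure_itv /= lte_fin.
rewrite lt_neqAle lu andbT; case: eqP => [->|_] /=; first by rewrite subrr.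
by rewrite EFinB.
Qed.

(* Infinite bounds are allowed so that half-spaces are orthants. *)
Definition orthant (b : 'I_n -> \bar R) : set 'rV[R]_n :=
  [set x | forall i, ((x ord0 i)%:E < b i)%E].

Definition orthants : set (set (borel_rV R n)) := range orthant.

Lemma orthants_setI : setI_closed orthants.
Proof.
move=> _ _ [b _ <-] [c _ <-]; exists (fun i => Order.min (b i) (c i)) => //.
apply/seteqP; split => [x xbc|x [xb xc] i].
  by split=> i; move: (xbc i); rewrite lt_min => /andP[].
by rewrite lt_min xb xc.
Qed.

Lemma orthantT : orthant (fun=> +oo%E) = setT.
Proof. by rewrite -subTset => x _ i; rewrite ltry. Qed.

Lemma measurable_orthant b : measurable (orthant b : set (borel_rV R n)).
Proof.
exists [set t : tupR n | forall i, [set y : measurableTypeR R | (y%:E < b i)%E] (tnth t i)].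
  apply: (@measurable_tuple_rect n (fun i => [set y : measurableTypeR R | (y%:E < b i)%E])).
  move=> i; case: (b i) => [r||].
  - rewrite (_ : mkset _ = `]-oo, r[%classic); first exact: measurable_itv.
    by apply/seteqP; split => x /=; rewrite in_itv/= lte_fin.
  - rewrite (_ : mkset _ = setT)//.
    by rewrite -subTset => x _ /=; rewrite ltry.
  - by rewrite (_ : mkset _ = set0)// -subset0 => x /=.
by rewrite setTI; apply/seteqP; split=> x /= H i; move: (H i); rewrite tnth_mktuple.
Qed.

(** Open left rays generate the Borel sets of the line, and the preimage of such a ray under one
    coordinate is the orthant whose other bounds are infinite. *)
Lemma borel_rV_orthants : @measurable _ (borel_rV R n) = <<s orthants >>.
Proof.
apply/seteqP; split => [_ [B mB <-]|]; last first.
  apply: smallest_sub; first exact: sigma_algebra_measurable.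
  by move=> _ [b _ <-]; exact: measurable_orthant.
suff mf : measurable_fun [set: g_sigma_algebraType orthants]
    (tuple_of_rV (n:=n) : g_sigma_algebraType orthants -> tupR n).
  exact: mf.
apply/measurable_fun_tnthP => i.
apply: (measurability _ (RGenInftyO.measurableE R)).
move=> _ [_ [r ->] <-]; apply: sub_sigma_algebra.
exists (fun j => if j == i then r%:E else +oo%E) => //.
rewrite setTI; apply/seteqP; split=> [x /(_ i)|x /=].
  by rewrite eqxx /= in_itv/= tnth_mktuple.
rewrite in_itv/= tnth_mktuple => xr j.
by case: eqP => [->|_]; rewrite ?lte_fin ?ltry.
Qed.

End boxes.

(** * Density of the span of orthant indicators in L^1 of a set of finite measure *)

Section l1_density.
Context {R : realType} {n : nat}.
Local Notation T := (lebesgue_rVType R n).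
Local Notation mu := (lebesgue_rV R n).
Variables (Q : set T) (V : set (T -> R)).
Hypotheses (mQ : measurable Q) (Qoo : (mu Q < +oo)%E).
Hypothesis VM : forall f, V f -> measurable_fun [set: T] f.
Hypothesis VD : forall f g, V f -> V g -> V (fun x => f x + g x).
Hypothesis VZ : forall a f, V f -> V (fun x => a * f x).
Hypothesis V1 : forall b, V \1_(orthant b : set T).
Hypothesis Vclosed : forall f, measurable_fun [set: T] f ->
  (l1norm mu Q f < +oo)%E ->
  (forall e : R, 0 < e ->
    exists2 g, V g & (l1norm mu Q (fun x => f x - g x)%R <= e%:E)%E) -> V f.

Lemma l1norm_indic (A : set T) : measurable A ->
  l1norm mu Q \1_A = mu (A `&` Q).
Proof.
by move=> mA; rewrite -integral_indic//; apply: eq_integral => x _; rewrite ger0_norm.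
Qed.

Lemma l1norm_indic_fin (A : set T) : measurable A -> (l1norm mu Q \1_A < +oo)%E.
Proof.
move=> mA; rewrite l1norm_indic//; apply: le_lt_trans Qoo.
by apply: le_measure; rewrite ?inE//; exact: measurableI.
Qed.

Lemma closed_sum (I : Type) (s : seq I) (c : I -> R) (f : I -> T -> R) :
  (forall i, V (f i)) -> V (fun x => \sum_(i <- s) c i * f i x).
Proof.
move=> Vf; elim: s => [|i s IH].
  rewrite (_ : (fun _ => _) = fun x : T => 0 * \1_(orthant (fun=> +oo%E) : set T) x).
    exact: VZ.
  by apply/funext => x; rewrite big_nil mul0r.
under eq_fun do rewrite big_cons.
by apply: VD => //; exact: VZ.
Qed.

Lemma closed_indic_borel (A : set (borel_rV R n)) : measurable A -> V \1_(A : set T).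
Proof.
rewrite borel_rV_orthants; move: A.
apply: (@dynkin_induction _ _ orthants (fun A : set (borel_rV R n) => V \1_(A : set T))).
- exact: borel_rV_orthants.
- exact: orthants_setI.
- by rewrite -orthantT; exact: V1.
- by move=> _ [b _ <-]; exact: V1.
- move=> S mS VS.
  rewrite (_ : \1__ = fun x : T => \1_(orthant (fun=> +oo%E) : set T) x + -1 * \1_(S : set T) x).
    by apply: VD => //; exact: VZ.
  apply/funext => x; rewrite orthantT !indicE in_setC in_setT mulN1r.
  by case: (x \in S); rewrite ?subrr ?subr0.
- move=> F mF tF VF.
  have mF' k : measurable (F k : set T) by exact: borel_lebesgue_measurable.
  have mU : measurable (\bigcup_k F k : set T) by exact: bigcupT_measurable.
  apply: Vclosed.
  + exact: measurable_indic.
  + exact: l1norm_indic_fin.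
  move=> e e0.
  (* [W m] is the part of the union, inside [Q], missed by the first [m] sets. These sets decrease
     to the empty set and [Q] has finite measure, so their measures tend to 0. *)
  pose U m : set T := \big[setU/set0]_(k < m) F k.
  pose W m : set T := Q `&` (\bigcup_k F k `\` U m).
  have mUm m : measurable (U m) by apply: bigsetU_measurable => k _; exact: mF'.
  have mW m : measurable (W m) by apply: measurableI => //; exact: measurableD.
  pose g m (x : T) : R := \sum_(k < m) 1 * \1_(F k : set T) x.
  have gE m x : g m x = \1_(U m) x.
    rewrite /g /U; elim: m => [|m IH]; first by rewrite !big_ord0 indic0.
    rewrite !big_ord_recr /= IH mul1r !indicE in_setU.
    have [xm|xm] := boolP (x \in F m); last by rewrite orbF addr0.
    rewrite orbT; case: (boolP (x \in _)) => [|_]; last by rewrite add0r.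
    rewrite inE -bigcup_mkord => -[k /= km Fkx].
    have kmE : k = m by apply: (tF k m I I); exists x; split => //; exact: set_mem.
    by rewrite kmE ltnn in km.
  have : mu (W m) @[m --> \oo] --> mu (\bigcap_m W m).
    apply: nonincreasing_cvg_mu => //.
    - by apply: le_lt_trans Qoo; apply: le_measure; rewrite ?inE//; exact: subIsetl.
    - exact: bigcap_measurable.
    - move=> p q pq; apply/subsetPset; apply: setIS; apply: setDS.
      exact: subset_bigsetU.
  rewrite (_ : \bigcap_m W m = set0); last first.
    rewrite -subset0 => x Wx; have [_ [[k _ Fkx] _]] := Wx 0 I.
    have [_ [_]] := Wx k.+1 I; apply.
    by rewrite /U -bigcup_mkord; exists k => /=.
  rewrite measure0 => W0.
  have [m Hm] : exists m, (mu (W m) < e%:E)%E.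
    have /W0 : nbhs (0%E : \bar R) [set y | (y < e%:E)%E] by 
      by apply: open_nbhs_nbhs; split; [exact: open_ereal_lt_ereal|rewrite /= lte_fin].
    by move=> [N _ H]; exists N; exact: (H N (leqnn N)).
  exists (g m).
    exact: (@closed_sum _ _ (fun=> 1) (fun k : 'I_m => \1_(F k : set T))).
  apply: le_trans (ltW Hm).
  rewrite -[X in mu X](_ : (\bigcup_k F k `\` U m : set T) `&` Q = W m); last by rewrite setIC.
  rewrite -l1norm_indic; last exact: measurableD.
  apply: (le_l1norm _ mQ).
    apply: measurable_funB; [exact: measurable_indic|apply: VM].
    exact: (@closed_sum _ _ (fun=> 1) (fun k : 'I_m => \1_(F k : set T))).
    by apply: measurable_indic; exact: measurableD.
  move=> x _; rewrite gE !indicE in_setD.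
  have [xU|xU] := boolP (x \in U m); rewrite ?andbT ?andbF ?subr0//.
  suff -> : x \in (\bigcup_k F k : set T) by rewrite subrr.
  by move: xU; rewrite !inE /U -bigcup_mkord => -[k _ ?]; exists k.
Qed.

(** [mu] is an outer measure built from Borel covers, so the part of [A] in [Q] is covered by a
    Borel set exceeding it by at most [e] in measure; on [Q] the two indicators differ only on that
    excess. *)
Lemma closed_indic (A : set T) : measurable A -> V \1_A.
Proof.
move=> mA; apply: Vclosed; [exact: measurable_indic|exact: l1norm_indic_fin|].
move=> e e0.
pose C : set T := A `&` Q.
have mC : measurable C by exact: measurableI.
have Coo : mu C \is a fin_num.
  rewrite ge0_fin_numE//; apply: le_lt_trans Qoo.
  by apply: le_measure; rewrite ?inE//; exact: subIsetr.
have [_ [F [mF CF] <-] Fe] := lb_ereal_inf_adherent e0 Coo.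
pose B : set (borel_rV R n) := \bigcup_k F k.
have mB : measurable B by exact: bigcupT_measurable.
have mB' : measurable (B : set T) by exact: borel_lebesgue_measurable.
have muB : (mu B <= mu C + e%:E)%E.
  apply: le_trans (ltW Fe).
  by apply: ereal_inf_lbound; exists F => //; split.
exists (\1_(B : set T)); first exact: closed_indic_borel.
apply: (@le_trans _ _ (l1norm mu Q \1_((B : set T) `\` C))).
  apply: (le_l1norm _ mQ).
  - by apply: measurable_funB; exact: measurable_indic.
  - by apply: measurable_indic; exact: measurableD.
  move=> x Qx; rewrite !indicE in_setD.
  have -> : (x \in A) = (x \in C).
    by apply/idP/idP; rewrite !inE; [move=> Ax; split|case].
  have [xC|xC] := boolP (x \in C); last by rewrite andbT sub0r normrN.
  suff -> : x \in (B : set T) by rewrite subrr.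
  by move: xC; rewrite !inE => /CF.
rewrite l1norm_indic; last exact: measurableD.
apply: (@le_trans _ _ (mu (B `\` C))).
  by apply: le_measure; rewrite ?inE;
    [apply: measurableI => //; exact: measurableD|exact: measurableD|exact: subIsetl].
move: muB; rewrite (measureDI mu mB' mC) setIidr// addeC.
by rewrite leeD2lE.
Qed.

Lemma closed_sfun (g : {sfun T >-> R}) : V g.
Proof.
have gE : (g : T -> R) = fun x => \sum_(y \in range g) y * \1_(g @^-1` [set y]) x.
  by apply/funext => x; rewrite fimfunE.
rewrite gE; under eq_fun do rewrite fsbig_finite//.
apply: closed_sum => y; apply: closed_indic.
by rewrite -[X in measurable X]setTI; exact: measurable_funP.
Qed.

(* Orthants generate the Borel sets and are stable under intersection, so
   indicators of Borel sets belong to [V] by the pi-lambda theorem; outer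
   regularity and simple functions give the rest. *)
Lemma l1_closed_full f : measurable_fun [set: T] f -> (l1norm mu Q f < +oo)%E -> V f.
Proof.
move=> mf foo; apply: Vclosed => // e e0.
have [g [_ _ g0]] := approximation_sfun_integrable mQ (l1norm_integrable mf foo).
have /g0 : nbhs (0%E : \bar R) [set y | (y < e%:E)%E].
  by apply: open_nbhs_nbhs; split; [exact: open_ereal_lt_ereal|rewrite /= lte_fin].
move=> [N _ H]; exists (g N); first exact: closed_sfun.
exact: (ltW (H N (leqnn N))).
Qed.

End l1_density.

(** * Counting grid points in an interval *)

Section lattice_counting.
Context {R : realType}.

Lemma count_ord_itv (m a b : nat) :
  (\sum_(j < m) (a <= j < b) = minn b m - a)%N.
Proof.
elim: m => [|m IH]; first by rewrite big_ord0 minn0.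
by rewrite big_ord_recr /= IH; lia.
Qed.

(** The integers of [a, b) are those from [ceil a] up to, but excluding, [ceil b]; the bounds on [a]
    and [b] ensure that the window [-N, N) contains all of them. *)
Lemma count_shifted_ord (N : nat) (a b : R) : - N%:R <= a -> a <= b -> b <= N%:R ->
  \sum_(j < N + N) (a <= j%:R - N%:R < b)%R%:R = (Num.ceil b - Num.ceil a)%:~R :> R.
Proof.
move=> Na ab bN.
have Nca : (- N%:Z <= Num.ceil a)%R.
  by rewrite -(intrKceil (R := R) (- N%:Z)) le_ceil// rmorphN.
have cab : (Num.ceil a <= Num.ceil b)%R by exact: le_ceil.
have cbN : (Num.ceil b <= N%:Z)%R by rewrite ceil_le_int.
have [p pE] : exists p : nat, (Num.ceil a + N%:Z = p%:Z)%R.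
  by exists (absz (Num.ceil a + N%:Z)%R); lia.
have [q qE] : exists q : nat, (Num.ceil b + N%:Z = q%:Z)%R.
  by exists (absz (Num.ceil b + N%:Z)%R); lia.
transitivity ((\sum_(j < N + N) (p <= j < q))%N%:R : R); last first.
  rewrite count_ord_itv pmulrn; congr (_%:~R); lia.
rewrite natr_sum; apply: eq_bigr => j _; congr ((nat_of_bool _)%:R).
rewrite (_ : j%:R - N%:R = (j%:Z - N%:Z)%:~R :> R); last by rewrite rmorphB.
rewrite -ceil_le_int -ceil_gt_int.
by move: (Num.ceil a) (Num.ceil b) pE qE => A B pE qE; clear -pE qE; lia.
Qed.

(** Factors are exchanged one at a time, those left in place having absolute value at most 1. *)
Lemma ler_norm_prodB (I : Type) (s : seq I) (c p : I -> R) :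
  (forall i, `|c i| <= 1) -> (forall i, `|p i| <= 1) ->
  `|\prod_(i <- s) c i - \prod_(i <- s) p i| <= \sum_(i <- s) `|c i - p i|.
Proof.
move=> c1 p1; elim: s => [|i s IH]; first by rewrite !big_nil subrr normr0.
rewrite !big_cons.
have -> : c i * \prod_(j <- s) c j - p i * \prod_(j <- s) p j =
  (c i - p i) * \prod_(j <- s) c j + p i * (\prod_(j <- s) c j - \prod_(j <- s) p j) by ring.
apply: le_trans (ler_normD _ _) _; rewrite !normrM lerD//.
  rewrite ler_piMr// normr_prod; elim: (s) => [|k r IHr]; first by rewrite big_nil.
  by rewrite big_cons mulr_ile1// prodr_ge0.
by apply: le_trans IH; rewrite ler_piMl.
Qed.

Variables (N : nat) (d l u x : R).
Hypotheses (N0 : (0 < N)%N) (d0 : 0 < d) (lxd : l <= x < l + d) (lu : l <= u)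
  (uld : u <= l + d).

Let N0R : 0 < N%:R :> R. Proof. by rewrite ltr0n. Qed.

(** Position of [v] seen from [x], in units of the step [d / N]: for an integer [k], the point
    [x + k * (d / N)] lies in [l, v) exactly when [k] lies in [scale l, scale v). *)
Let scale (v : R) := (v - x) * (N%:R / d).

Let le_scale : {homo scale : v w / v <= w}.
Proof. by move=> v w vw; rewrite ler_wpM2r ?divr_ge0 ?(ltW d0)// lerD2r. Qed.

Let scaleDd : scale (l + d) = scale l + N%:R.
Proof. by rewrite /scale; field; rewrite ?gt_eqF. Qed.

Let scaleB v w : (v - w) / d = N%:R^-1 * (scale v - scale w).
Proof. by rewrite /scale; field; rewrite ?gt_eqF. Qed.

Let count_itv (v : R) : l <= v -> v <= l + d ->
  \sum_(j < N + N) (l <= x + (j%:R - N%:R) * (d / N%:R) < v)%R%:R =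
  (Num.ceil (scale v) - Num.ceil (scale l))%:~R :> R.
Proof.
move=> lv vld; have /andP[lx xd] := lxd; have dN0 : 0 < d / N%:R by rewrite divr_gt0.
have scalex : scale x = 0 by rewrite /scale subrr mul0r.
(* Since [x] lies in [l, l + d), whose image under [scale] has length [N] and contains 0, all
   relevant integers lie in [-N, N). *)
have sl : - N%:R <= scale l.
  have : scale x <= scale (l + d) by apply: le_scale; lra.
  by rewrite scaleDd scalex; lra.
rewrite -(count_shifted_ord sl); last 2 first.
- exact: le_scale.
- have : scale l <= scale x by apply: le_scale; lra.
  by have := le_scale vld; rewrite scaleDd scalex; lra.
apply: eq_bigr => j _; congr ((nat_of_bool (_ && _))%:R); rewrite /scale -[N%:R / d]invf_div.
  by rewrite ler_pdivrMr// lerBlDl.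
by rewrite ltr_pdivlMr// ltrBrDl.
Qed.

(** The interval is exactly [N] steps long, so the two ceilings differ by exactly [N], whatever the
    position of [x]. *)
Lemma grid_density_full :
  N%:R^-1 * \sum_(j < N + N) (l <= x + (j%:R - N%:R) * (d / N%:R) < l + d)%R%:R = 1 :> R.
Proof.
rewrite count_itv//; last by rewrite lerDl ltW.
have cN : Num.ceil (N%:R : R) = N%:Z by rewrite -[N%:R]/(N%:Z%:~R) intrKceil.
by rewrite scaleDd ceilDrz ?natr_int// cN addrAC subrr add0r mulVf ?gt_eqF.
Qed.

Lemma grid_density_le1 :
  `|N%:R^-1 * \sum_(j < N + N) (l <= x + (j%:R - N%:R) * (d / N%:R) < u)%R%:R| <= 1 :> R.
Proof.
rewrite ger0_norm; last by rewrite mulr_ge0 ?invr_ge0// sumr_ge0.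
rewrite -[X in _ <= X]grid_density_full ler_wpM2l ?invr_ge0// ler_sum// => j _.
rewrite ler_nat; case: (l <= _) => //=.
by case: ltP => // h; rewrite (lt_le_trans h uld).
Qed.

(** Taking ceilings moves each end by less than one step, so the count differs from the length in
    steps by less than 1. *)
Lemma grid_density_error :
  `|N%:R^-1 * \sum_(j < N + N) (l <= x + (j%:R - N%:R) * (d / N%:R) < u)%R%:R
    - (u - l) / d| <= N%:R^-1.
Proof.
rewrite count_itv// scaleB -mulrBr normrM gtr0_norm ?invr_gt0//.
rewrite ler_piMr ?invr_ge0// rmorphB/=.
have := ceil_itv (scale u); have := ceil_itv (scale l).
rewrite !rmorphB /= ler_norml => /andP[? ?] /andP[? ?]; lra.
Qed.

End lattice_counting.

(** * Averages over grid translates and their uniform L^1 bound *)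

Section grid_averages.
Context {R : realType} {n : nat}.
Local Notation T := (lebesgue_rVType R n).
Local Notation mu := (lebesgue_rV R n).

(* [j i - K] ranges over the integers of [-K, K). *)
Definition gridpt (K : nat) (d : R) (j : {ffun 'I_n -> 'I_(K + K)}) : 'rV[R]_n :=
  \row_i (((j i)%:R - K%:R) * d).

Variables (l : 'I_n -> R) (d : R).
Hypothesis d0 : 0 < d.

Definition cube : set T := box l (fun i => l i + d).

Definition cube_mean (f : T -> R) : R := d ^- n * (\int[mu]_(x in cube) f x)%R.

(* For [x] in the cube, exactly [N ^ n] of the [(2 N) ^ n] translates of [x] lie in
   it (see [grid_mean_full]); this is why the factor is [N ^- n]. *)
Definition grid_mean (N : nat) (f : T -> R) (x : T) : R :=
  N%:R ^- n * \sum_(j : {ffun 'I_n -> 'I_(N + N)})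
    (f \* \1_cube) ((x : 'rV[R]_n) + gridpt (d / N%:R) j).

Lemma measurable_cube : measurable cube.
Proof. exact: measurable_box. Qed.

Lemma lebesgue_cube : mu cube = (d ^+ n)%:E.
Proof.
rewrite lebesgue_rV_box => [|i]; last by rewrite lerDl ltW.
by under eq_bigr do rewrite addrC addKr; rewrite prodr_const card_ord.
Qed.

Lemma measurable_cube_restrict (f : T -> R) :
  measurable_fun [set: T] f -> measurable_fun [set: T] (f \* \1_cube).
Proof.
by move=> mf; apply: (measurable_funM mf); exact: measurable_indic measurable_cube.
Qed.

Lemma measurable_grid_term (f : T -> R) xi : measurable_fun [set: T] f ->
  measurable_fun [set: T] (fun x : T => (f \* \1_cube) ((x : 'rV[R]_n) + xi)).
Proof. by move=> mf; exact: measurable_translate (measurable_cube_restrict mf). Qed.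

Lemma measurable_grid_mean N (f : T -> R) :
  measurable_fun [set: T] f -> measurable_fun [set: T] (grid_mean N f).
Proof.
move=> mf; apply: measurable_funM; first exact: measurable_cst.
by apply: measurable_sum => j; exact: measurable_grid_term.
Qed.

Lemma grid_meanD N (f g : T -> R) x :
  grid_mean N (fun x => f x + g x) x = grid_mean N f x + grid_mean N g x.
Proof.
rewrite /grid_mean -mulrDr -big_split; congr (_ * _).
by apply: eq_bigr => j _; rewrite /= mulrDl.
Qed.

Lemma grid_meanZ N a (f : T -> R) x :
  grid_mean N (fun x => a * f x) x = a * grid_mean N f x.
Proof.
rewrite /grid_mean mulrCA; congr (_ * _); rewrite big_distrr.
by apply: eq_bigr => j _; rewrite /= mulrA.
Qed.

(** By translation invariance each of the [(2 N) ^ n] translates contributes at most the norm of [f]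
    on the cube, and the weight [N ^- n] leaves [2 ^ n]. *)
Lemma l1norm_grid_mean N (f : T -> R) : (0 < N)%N -> measurable_fun [set: T] f ->
  (l1norm mu cube (grid_mean N f) <= (2 ^+ n)%:E * l1norm mu cube f)%E.
Proof.
move=> N0 mf.
pose h (y : T) : \bar R := `|(f \* \1_cube) y|%:E.
have mh : measurable_fun [set: T] h.
  exact: measurable_normr_EFin (measurable_cube_restrict mf).
have h0 y : (0 <= h y)%E by rewrite lee_fin.
have hE : (\int[mu]_x h x = l1norm mu cube f)%E.
  by rewrite l1norm_restrict.
have Nn0 : 0 <= N%:R ^- n :> R by rewrite invr_ge0 exprn_ge0.
pose H (x : T) : \bar R := (\sum_(j : {ffun 'I_n -> 'I_(N + N)})
     h ((x : 'rV[R]_n) + gridpt (d / N%:R) j)%R)%E.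
have mhj (j : {ffun 'I_n -> 'I_(N + N)}) :
    measurable_fun [set: T] (fun x : T => h ((x : 'rV[R]_n) + gridpt (d / N%:R) j)%R).
  exact: (measurableT_comp mh (measurable_lebesgue_shift _)).
have mH : measurable_fun [set: T] H by exact: emeasurable_sum.
have H0 x : (0 <= H x)%E by exact: sume_ge0.
apply: (@le_trans _ _ (\int[mu]_(x in cube) ((N%:R ^- n)%:E * H x))%E).
  apply: ge0_le_integral.
  - exact: measurable_cube.
  - by move=> x _; rewrite lee_fin.
  - exact: measurable_normr_EFin (measurable_grid_mean _ mf).
  - by apply: measurable_funTS; exact: measurable_funeM.
  - move=> x _; rewrite /grid_mean /H /h sumEFin -EFinM lee_fin normrM (ger0_norm Nn0).
    by rewrite ler_wpM2l// ler_norm_sum.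
(* The domain is enlarged to the whole space, where the integral is invariant under translation. *)
apply: (@le_trans _ _ (\int[mu]_x ((N%:R ^- n)%:E * H x))%E).
  apply: ge0_subset_integral.
  - exact: measurable_cube.
  - exact: measurableT.
  - exact: measurable_funeM.
  - by move=> x _; rewrite mule_ge0// lee_fin.
  - exact: subsetT.
rewrite (ge0_integralZl_EFin _ measurableT (fun x _ => H0 x) mH Nn0).
rewrite (ge0_integral_sum _ measurableT mhj (fun j x _ => h0 _)).
under eq_bigr do rewrite (ge0_integral_shift _ mh h0) hE.
under eq_bigr do rewrite -[l1norm _ _ _]mul1e.
rewrite -ge0_sume_distrl// sumEFin sumr_const card_ffun !card_ord muleA.
rewrite -EFinM lee_wpmul2r ?l1norm_ge0// lee_fin.
by rewrite natrX natrD -exprVn -exprMn mulrDr mulVf ?pnatr_eq0 -?lt0n.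
Qed.

Lemma cube_mean_bound (f : T -> R) : measurable_fun [set: T] f ->
  (l1norm mu cube f < +oo)%E ->
  (`|cube_mean f|%:E * mu cube <= l1norm mu cube f)%E.
Proof.
move=> mf foo; have intf := l1norm_integrable mf foo.
have dn0 : 0 < d ^+ n by rewrite exprn_gt0.
rewrite lebesgue_cube -EFinM /cube_mean normrM gtr0_norm ?invr_gt0//.
rewrite mulrAC mulVf ?gt_eqF// mul1r (EFin_normr_Rintegral measurable_cube intf).
by apply: le_abse_integral; [exact: measurable_cube|exact: measurable_int intf].
Qed.

Lemma l1norm_cst (c : R) : l1norm mu cube (fun=> c) = (`|c|%:E * mu cube)%E.
Proof. by exact: integral_cst measurable_cube _. Qed.

End grid_averages.

(** * Convergence of grid averages to the mean in L^1 of the cube *)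

Section grid_mean_convergence.
Context {R : realType} {n : nat}.
Local Notation T := (lebesgue_rVType R n).
Local Notation mu := (lebesgue_rV R n).
Variables (l : 'I_n -> R) (d : R).
Hypothesis d0 : 0 < d.
Local Notation Q := (cube l d).
Local Notation mQ := (measurable_cube l d).
Local Notation grid_mean := (grid_mean l d).
Local Notation cube_mean := (cube_mean l d).

(** The indicator of a box is a product over the coordinates, and a sum over multi-indices of such
    products is the product of the one-dimensional sums. The bound on [u] puts the box inside the
    cube. *)
Lemma grid_mean_box N (u : 'I_n -> R) (x : T) :
  (forall i, u i <= l i + d) ->
  grid_mean N \1_(box l u : set T) x =
  \prod_(i < n) (N%:R^-1 *
    \sum_(k < N + N) (l i <= (x : 'rV[R]_n) ord0 i + (k%:R - N%:R) * (d / N%:R) < u i)%R%:R).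
Proof.
move=> ul; rewrite /grid_mean big_split /= prodr_const card_ord exprVn; congr (_ * _).
rewrite bigA_distr_bigA /=; apply: eq_bigr => j _.
rewrite -natr_prod !indicE -natrM mulnb; congr _%:R.
have -> : forall p : 'I_n -> bool, (\prod_(i < n) p i)%N = [forall i, p i].
  move=> p; have [/forallP pT|] := boolP [forall i, p i].
    by rewrite big1// => i _; rewrite pT.
  by rewrite negb_forall => /existsP[i pi]; rewrite (bigD1 i)//= (negbTE pi) mul0n.
congr nat_of_bool; apply/andP/forallP => [[/set_mem xu _] i|xu].
  by have := xu i; rewrite !mxE.
have xb : box l u ((x : 'rV[R]_n) + gridpt (d / N%:R) j).
  by move=> i; have := xu i; rewrite !mxE.
split; apply/mem_set => // i; have /andP[-> /=] := xb i.
by move=> /lt_le_trans; apply.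
Qed.

Lemma grid_mean_full N (x : T) : (0 < N)%N -> Q x ->
  grid_mean N \1_Q x = 1.
Proof.
move=> N0 Qx; rewrite grid_mean_box//; apply: big1 => i _.
exact: grid_density_full.
Qed.

Lemma cube_mean_box (u : 'I_n -> R) :
  (forall i, l i <= u i <= l i + d) ->
  cube_mean \1_(box l u : set T) = \prod_(i < n) ((u i - l i) / d).
Proof.
move=> ul.
have uQ : (box l u : set T) `<=` Q.
  move=> x xu i; have /andP[-> /=] := xu i; move=> /lt_le_trans; apply.
  by have /andP[] := ul i.
rewrite /cube_mean /Rintegral integral_indic; [|exact: mQ|exact: measurable_box].
rewrite setIidl// lebesgue_rV_box => [|i]; last by have /andP[] := ul i.
by rewrite big_split /= prodr_const card_ord exprVn mulrC.
Qed.

Definition grid_mean_cvg_to_mean (f : T -> R) := forall e : R, 0 < e ->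
  \forall N \near \oo, (l1norm mu Q (fun x => grid_mean N f x - cube_mean f)%R <= e%:E)%E.

(** Each coordinate density is off by at most [1 / N], hence the product by at most [n / N],
    uniformly on the cube. *)
Lemma grid_mean_cvg_box (u : 'I_n -> R) : (forall i, l i <= u i <= l i + d) ->
  grid_mean_cvg_to_mean \1_(box l u : set T).
Proof.
move=> ul e e0.
(* The L^1 error is at most [n * d ^ n / N]; the added 1 keeps [c] positive even for [n = 0]. *)
pose c := n%:R * d ^+ n + 1.
have c0 : 0 < c by rewrite ltr_pwDr// mulr_ge0// exprn_ge0// ltW.
near=> N.
have N0 : (0 < N)%N by near: N; exists 1%N.
have Ne : N%:R^-1 * c <= e.
  rewrite mulrC ler_pdivrMr ?ltr0n// mulrC -ler_pdivrMr//.
  by near: N; exact: nbhs_infty_ger.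
apply: (@le_trans _ _ (l1norm mu Q (fun=> n%:R / N%:R))).
  apply: (le_l1norm _ mQ).
  - apply: measurable_funB; last exact: measurable_cst.
    by apply: measurable_grid_mean; apply: measurable_indic; exact: measurable_box.
  - exact: measurable_cst.
  move=> x Qx; rewrite grid_mean_box => [|i]; last by have /andP[] := ul i.
  rewrite cube_mean_box// [leRHS]ger0_norm ?divr_ge0//.
  apply: le_trans (ler_norm_prodB _ _ _) _.
  - move=> i; have /andP[? ?] := ul i; exact: grid_density_le1.
  - move=> i; have /andP[? ?] := ul i.
    by rewrite ger0_norm ?divr_ge0 ?(ltW d0) ?subr_ge0// ler_pdivrMr// mul1r lerBlDl.
  apply: (@le_trans _ _ (\sum_(i < n) N%:R^-1)).
    apply: ler_sum => i _; have /andP[? ?] := ul i; exact: grid_density_error.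
  by rewrite sumr_const card_ord mulr_natl.
rewrite l1norm_cst lebesgue_cube// -EFinM lee_fin ger0_norm ?divr_ge0//.
apply: le_trans Ne; rewrite mulrAC mulrC ler_wpM2l ?invr_ge0//.
by rewrite /c lerDl.
Unshelve. all: by end_near. Qed.

Lemma grid_mean_cvg_orthant (b : 'I_n -> \bar R) :
  grid_mean_cvg_to_mean \1_(orthant b : set T).
Proof.
(* Both averages only see the cube, where the orthant is a box: its bounds are clipped to
   [l i, l i + d], with [u i = l i], hence an empty box, when [b i] is below [l i]. *)
pose u i := fine (maxe (l i)%:E (mine (b i) (l i + d)%:E)).
have ul i : l i <= u i <= l i + d.
  rewrite /u; case: (b i) => [r||].
  - rewrite -EFin_min -EFin_max /= le_max lexx /= ge_max lerDl (ltW d0) /=.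
    by rewrite ge_min lexx orbT.
  - by rewrite min_r ?leey// -EFin_max /= le_max lexx /= ge_max lerDl (ltW d0) lexx.
  - by rewrite min_l ?leNye// max_l ?leNye//= lexx lerDl ltW.
have QE : orthant b `&` Q = box l u.
  apply/seteqP; split => [x [xb xQ] i|x xu].
    have /andP[-> /= xd] := xQ i; rewrite /u; move: (xb i); case: (b i) => [r||].
    - by rewrite lte_fin => xr; rewrite -EFin_min -EFin_max/= lt_max lt_min xr xd orbT.
    - by rewrite min_r ?leey// -EFin_max /= lt_max xd orbT.
    - by [].
  suff H i : ((x ord0 i)%:E < b i)%E /\ l i <= x ord0 i < l i + d.
    by split => i; have [] := H i.
  have /andP[lx] := xu i; rewrite lx /u; case: (b i) => [r||].
  - rewrite -EFin_min -EFin_max/= lt_max ltNge lx /= lt_min => /andP[xr xd].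
    by rewrite lte_fin.
  - by rewrite min_r ?leey// -EFin_max /= lt_max ltNge lx /= ltry.
  - by rewrite min_l ?leNye// max_l ?leNye//= ltNge lx.
have gE N : grid_mean N \1_(orthant b : set T) = grid_mean N \1_(box l u : set T).
  apply/funext => x; congr (_ * _); apply: eq_bigr => j _.
  rewrite -QE /= !indicE in_setI; case: (_ \in orthant b); case: (_ \in Q);
  by rewrite /= ?mulr0 ?mulr1 ?mul0r.
have cE : cube_mean \1_(orthant b : set T) = cube_mean \1_(box l u : set T).
  congr (_ * _); apply: eq_Rintegral => x xQ.
  by rewrite -QE /= !indicE in_setI xQ andbT.
move=> e e0; near=> N; rewrite cE.
rewrite (_ : (fun x => _) =
    fun x => grid_mean N \1_(box l u : set T) x - cube_mean \1_(box l u : set T)).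
  by near: N; exact: grid_mean_cvg_box.
by apply/funext => x; rewrite gE.
Unshelve. all: by end_near. Qed.

Lemma cube_meanD (f g : T -> R) :
  measurable_fun [set: T] f -> (l1norm mu Q f < +oo)%E ->
  measurable_fun [set: T] g -> (l1norm mu Q g < +oo)%E ->
  cube_mean (fun x => f x + g x) = cube_mean f + cube_mean g.
Proof.
move=> mf foo mg goo; rewrite /cube_mean -mulrDr; congr (_ * _).
exact: (RintegralD mQ (l1norm_integrable mf foo) (l1norm_integrable mg goo)).
Qed.

Lemma cube_meanZ (a : R) (f : T -> R) :
  measurable_fun [set: T] f -> (l1norm mu Q f < +oo)%E ->
  cube_mean (fun x => a * f x) = a * cube_mean f.
Proof.
move=> mf foo; rewrite /cube_mean mulrCA; congr (_ * _).
exact: (RintegralZl _ mQ (l1norm_integrable mf foo)).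
Qed.

(** The functions with this property form a linear space containing the orthant indicators. It is
    closed in L^1 of the cube because the operators grid mean minus mean are bounded there uniformly
    in [N]. *)
Lemma grid_mean_cvg (f : T -> R) : measurable_fun [set: T] f ->
  (l1norm mu Q f < +oo)%E -> grid_mean_cvg_to_mean f.
Proof.
move=> mf foo.
pose V : set (T -> R) := [set f | [/\ measurable_fun [set: T] f,
  (l1norm mu Q f < +oo)%E & grid_mean_cvg_to_mean f]].
suff : V f by case.
have Qoo : (mu Q < +oo)%E by rewrite lebesgue_cube// ltry.
have mdev N (h : T -> R) : measurable_fun [set: T] h ->
    measurable_fun [set: T] (fun x => grid_mean N h x - cube_mean h).
  move=> mh; apply: measurable_funB; last exact: measurable_cst.
  exact: measurable_grid_mean.
have ltD (g h : T -> R) : measurable_fun [set: T] g -> measurable_fun [set: T] h ->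
    (l1norm mu Q g < +oo)%E -> (l1norm mu Q h < +oo)%E ->
    (l1norm mu Q (fun x => g x + h x)%R < +oo)%E.
  by move=> mg mh goo hoo; apply: le_lt_trans (l1normD _ mQ mg mh) _; rewrite lte_add_pinfty.
have devD N (g h : T -> R) : measurable_fun [set: T] g -> measurable_fun [set: T] h ->
    (l1norm mu Q g < +oo)%E -> (l1norm mu Q h < +oo)%E ->
    (l1norm mu Q (fun x => grid_mean N (fun x => g x + h x) x -
       cube_mean (fun x => g x + h x))%R <=
     l1norm mu Q (fun x => grid_mean N g x - cube_mean g)%R +
     l1norm mu Q (fun x => grid_mean N h x - cube_mean h)%R)%E.
  move=> mg mh goo hoo.
  apply: le_trans (l1normD _ mQ (mdev N _ mg) (mdev N _ mh)).
  rewrite /l1norm; under eq_integral do rewrite grid_meanD cube_meanD// opprD addrACA.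
  exact: lexx.
apply: (l1_closed_full mQ Qoo (V := V)) mf foo.
- by move=> g [].
- move=> g h [mg goo Vg] [mh hoo Vh]; split; [exact: measurable_funD|exact: ltD|].
  move=> e e0; have e20 : 0 < e / 2 by exact: divr_gt0.
  apply: filterS2 (Vg _ e20) (Vh _ e20) => N gN hN.
  apply: le_trans (devD _ _ _ mg mh goo hoo) _.
  by rewrite [X in (_ <= X%:E)%E](splitr e) EFinD; exact: leeD gN hN.
- move=> a g [mg goo Vg]; split.
  + by apply: measurable_funM; [exact: measurable_cst|exact: mg].
  + by rewrite (l1normZ _ mQ)// lte_mul_pinfty// lee_fin.
  move=> e e0; have a0 : 0 < `|a| + 1 by rewrite ltr_wpDl.
  apply: filterS (Vg _ (divr_gt0 e0 a0)) => N gN.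
  have := l1normZ mu mQ a (mdev N _ mg).
  rewrite /l1norm; under [in X in X -> _]eq_integral do rewrite mulrBr -grid_meanZ -cube_meanZ//.
  move=> ->; apply: (@le_trans _ _ (`|a|%:E * (e / (`|a| + 1))%:E)%E).
    by apply: lee_wpmul2l gN; rewrite lee_fin.
  by rewrite -EFinM lee_fin mulrA ler_pdivrMr// mulrC ler_pM2l// lerDl.
- move=> b; have mO := borel_lebesgue_measurable (measurable_orthant b).
  by split; [exact: measurable_indic mO|exact: (l1norm_indic_fin mQ Qoo mO)|
    exact: grid_mean_cvg_orthant].
- move=> g mg goo gV; split => // e e0.
  (* Operator bound of the difference: [2 ^ n] from the grid mean and 1 from the mean. *)
  pose c : R := 2 ^+ n + 1.
  have c0 : 0 < c by rewrite ltr_wpDl// exprn_ge0.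
  have e20 : 0 < e / 2 by exact: divr_gt0.
  have [h [mh hoo Vh] gh] := gV (e / 2 / c) (divr_gt0 e20 c0).
  have mgh : measurable_fun [set: T] (fun x => g x - h x) by exact: measurable_funB.
  have ghoo : (l1norm mu Q (fun x => g x - h x)%R < +oo)%E.
    by apply: le_lt_trans gh _; rewrite ltry.
  have devgh N : (0 < N)%N ->
    (l1norm mu Q (fun x => grid_mean N (fun x => g x - h x) x -
       cube_mean (fun x => g x - h x))%R <= (e / 2)%:E)%E.
    move=> N0; apply: le_trans (l1normB _ mQ _ _) _.
    + exact: measurable_grid_mean.
    + exact: measurable_cst.
    rewrite l1norm_cst.
    apply: (@le_trans _ _ (c%:E * l1norm mu Q (fun x => g x - h x)%R)%E).
      rewrite /c EFinD ge0_muleDl ?lee_fin// ?exprn_ge0// mul1e; apply: leeD.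
        exact: l1norm_grid_mean.
      exact: cube_mean_bound.
    apply: (@le_trans _ _ (c%:E * (e / 2 / c)%:E)%E).
      by apply: lee_wpmul2l gh; rewrite lee_fin ltW.
    by rewrite -EFinM lee_fin mulrCA mulfV ?mulr1// gt_eqF.
  apply: filterS2 (Vh _ e20) (nbhs_infty_gt 0) => N hN N0.
  have := devD N _ _ mh mgh hoo ghoo.
  rewrite (_ : (fun x => h x + (g x - h x)) = g); last first.
    by apply/funext => x; rewrite addrC subrK.
  move=> /le_trans; apply.
  by rewrite [X in (_ <= X%:E)%E](splitr e) EFinD; exact: leeD hN (devgh _ N0).
Qed.

End grid_mean_convergence.

(** * Markov's inequality and the Borel-Cantelli lemma *)

Section borel_cantelli.
Context d {T : measurableType d} {R : realType}.
Variables (mu : {measure set T -> \bar R}) (W : nat -> T -> R) (c : nat -> R).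
Hypotheses (mW : forall k, measurable_fun [set: T] (W k))
  (W0 : forall k x, 0 <= W k x) (c0 : forall k, 0 < c k).

Lemma measurable_superlevel k : measurable [set x | c k <= W k x].
Proof.
rewrite (_ : mkset _ = W k @^-1` `[c k, +oo[%classic).
  by rewrite -[X in measurable X]setTI; exact: mW.
by apply/seteqP; split => x /=; rewrite in_itv/= andbT.
Qed.

Hypothesis Wc : forall k, (\int[mu]_x (W k x)%:E <= (c k * c k)%:E)%E.
Hypothesis csum : (\sum_(k <oo) (c k)%:E < +oo)%E.

(** By Markov's inequality the [k]-th superlevel set has measure at most [c k], which is
    summable. *)
Lemma limsup_superlevel_eq0 : mu (lim_sup_set (fun k => [set x | c k <= W k x])) = 0%E.
Proof.
apply: lim_sup_set_cvg0; first exact: measurable_superlevel.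
apply: le_lt_trans csum; apply: lee_nneseries => // k _.
have ck : (0 < (c k)%:E)%E by rewrite lte_fin.
rewrite -(@lee_pmul2l _ (c k)%:E)// -EFinM.
apply: le_trans (Wc k).
rewrite -[X in mu X]setIT -integral_indic//; last exact: measurable_superlevel.
rewrite -ge0_integralZl_EFin//; last 2 first.
- by apply/measurable_EFinP; apply: measurable_indic; exact: measurable_superlevel.
- exact: ltW.
apply: ge0_le_integral => //.
- by move=> x _; rewrite mule_ge0// lee_fin ?ltW.
- apply/measurable_EFinP; apply: measurable_funM => //.
  by apply: measurable_indic; exact: measurable_superlevel.
- exact/measurable_EFinP.
move=> x _; rewrite -EFinM lee_fin indicE.
by case: (boolP (x \in _)) => [|_]; rewrite ?mulr0 ?W0// inE /= mulr1.
Qed.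

End borel_cantelli.

(** * The norm of a ball Banach function space and L^1 approximation *)

Section ball_banach.
Context {R : realType} {n : nat} (X : ballBanachFunctionSpace R n).
Local Notation T := (lebesgue_rVType R n).
Local Notation mu := (lebesgue_rV R n).
Local Notation N := (bbfs_norm X).
Implicit Types f g h : 'rV[R]_n -> R.

Lemma bbfs_mem f : (N f < +oo)%E -> bbfs_space X f.
Proof. by move=> Nf; apply: contrapT => /bbfs_norm_out NX; rewrite NX in Nf. Qed.

Lemma le_bbfs_norm f g : lebesgue_measurable_fun f -> lebesgue_measurable_fun g ->
  (forall x, `|g x| <= `|f x|) -> (N g <= N f)%E.
Proof. by move=> mf mg gf; apply: (bbfs_lattice X mf mg); exact: aeW. Qed.

Lemma bbfs_norm0 : N (fun=> 0) = 0%E.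
Proof.
have := bbfs_normZ 0 (bbfs_space0 X); rewrite normr0 mul0e.
by congr (N _ = _); apply/funext => x /=; rewrite mul0r.
Qed.

(** Extends homogeneity, as an inequality, to measurable functions of infinite norm. *)
Lemma bbfs_normZ_le (a : R) f : 0 < a -> lebesgue_measurable_fun f ->
  (N (fun x => a * f x)%R <= a%:E * N f)%E.
Proof.
move=> a0 mf; have [Nf|] := ltP (N f) +oo%E.
  by rewrite [X in (X <= _)%E](bbfs_normZ a (bbfs_mem Nf)) gtr0_norm.
by rewrite leye_eq => /eqP ->; rewrite gt0_muley ?leey ?lte_fin.
Qed.

Lemma bbfs_normB_sym f g : lebesgue_measurable_fun f -> lebesgue_measurable_fun g ->
  N (f \- g) = N (g \- f).
Proof.
move=> mf mg; apply/eqP; rewrite eq_le; apply/andP.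
have mfg := measurable_funB mf mg; have mgf := measurable_funB mg mf.
by split; [apply: (le_bbfs_norm mgf mfg)|apply: (le_bbfs_norm mfg mgf)] => x /=;
  rewrite distrC.
Qed.

Lemma bbfs_norm_sum (I : Type) (s : seq I) (f : I -> 'rV[R]_n -> R) :
  (forall i, lebesgue_measurable_fun (f i)) ->
  (N (fun x => \sum_(i <- s) f i x)%R <= \sum_(i <- s) N (f i))%E.
Proof.
move=> mf; elim: s => [|i s IH].
  by under eq_fun do rewrite big_nil; rewrite big_nil bbfs_norm0.
under eq_fun do rewrite big_cons; rewrite big_cons.
apply: le_trans (bbfs_normD X (mf i) (measurable_sum s mf)) _.
exact: leeD2l.
Qed.

Let c k : R := 1 / (2 ^ k.+1)%:R.
Let c0 k : 0 < c k. Proof. by rewrite /c divr_gt0// ltr0n expn_gt0. Qed.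

Let cS : nonincreasing_seq c.
Proof.
apply/nonincreasing_seqP => k; rewrite /c !div1r lef_pV2 ?posrE ?ltr0n ?expn_gt0//.
by rewrite ler_nat leq_exp2l.
Qed.

Let cvgc (e : R) : 0 < e -> \forall k \near \oo, c k <= e.
Proof.
move=> e0; near=> k; rewrite /c ler_pdivrMr ?ltr0n ?expn_gt0// mulrC -ler_pdivrMr// div1r.
apply: (@le_trans _ _ k%:R); first by near: k; exact: nbhs_infty_ger.
by rewrite ler_nat ltnW// (leq_trans (ltnSn k))// ltnW// ltn_expl.
Unshelve. all: by end_near. Qed.

(* A substitute for Minkowski's integral inequality: along a sequence, the
   errors [W] tend to zero outside a null set, so the Fatou property passes
   the bound on [G] to the limit [h]. *)
Lemma bbfs_norm_le_l1_approx h (C : \bar R) : lebesgue_measurable_fun h ->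
  (forall e : R, 0 < e -> exists G : 'rV[R]_n -> R, exists W : 'rV[R]_n -> R,
     [/\ lebesgue_measurable_fun G, lebesgue_measurable_fun W,
         forall x, 0 <= W x /\ `|h x| <= `|G x| + W x, (N G <= C)%E &
         (\int[mu]_x (W x)%:E <= e%:E)%E]) ->
  (N h <= C)%E.
Proof.
move=> mh approx.
(* The tolerance is the square of [c k], so that Markov's inequality leaves the summable bound
   [c k]. *)
have /choice[G /choice[W GW]] k := approx (c k * c k) (mulr_gt0 (c0 k) (c0 k)).
have mG k : lebesgue_measurable_fun (G k) by have [] := GW k.
have mW k : lebesgue_measurable_fun (W k) by have [] := GW k.
have W0 k x : 0 <= W k x by have [_ _ /(_ x)[]] := GW k.
have hGW k x : `|h x| <= `|G k x| + W k x by have [_ _ /(_ x)[]] := GW k.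
pose bad k : set T := [set x | c k <= W k x].
have mbad k : measurable (bad k) by exact: (measurable_superlevel c mW).
have bad0 : mu (lim_sup_set bad) = 0%E.
  apply: (limsup_superlevel_eq0 mW W0 c0); first by move=> k; have [] := GW k.
  by apply: le_lt_trans (epsilon_trick0 _ ler01) _; rewrite ltry.
pose B k : set T := \bigcup_(j in [set j | (k <= j)%N]) bad j.
have mB k : measurable (B k) by apply: bigcup_measurable => j _; exact: mbad.
have BS j k : (j <= k)%N -> B k `<=` B j.
  by move=> jk x [i ki ix]; exists i => //; exact: leq_trans jk ki.
have mlim : measurable (lim_sup_set bad).
  by apply: bigcapT_measurable => k; exact: mB.
(* Off the limsup set [u k] increases to the absolute value of [h], since [c k] decreases to 0 and
   [B k] shrinks. Off [B k] the error [W k] is below [c k], so [u k] is dominated by [G k]. *)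
pose u k x := Num.max 0 (`|h x| - c k) * \1_(~` B k) x.
have mabs : lebesgue_measurable_fun (fun x => `|h x|).
  exact: (measurableT_comp (@normr_measurable R setT) mh).
have mu_ k : lebesgue_measurable_fun (u k).
  apply: measurable_funM.
    apply: (measurable_maxr (measurable_cst _)).
    by apply: (measurable_funB mabs); exact: measurable_cst.
  by apply: measurable_indic; exact: measurableC (mB k).
have u0 k x : 0 <= u k x by rewrite mulr_ge0// le_max lexx.
have uG k x : `|u k x| <= `|G k x|.
  rewrite ger0_norm// /u indicE in_setC; case: (boolP (x \in B k)) => xB /=.
    by rewrite mulr0.
  rewrite mulr1 ge_max normr_ge0 /= lerBlDr; apply: le_trans (hGW k x) _.
  rewrite lerD2l leNgt; apply: contra xB => /ltW cW; apply/mem_set.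
  by exists k => //=.
have [_ Ncvg] : nondecreasing_seq (N \o u) /\
    (N (u k) @[k --> \oo] --> N (fun x => `|h x|)).
  apply: bbfs_fatou => //.
  exists (lim_sup_set bad); split; [exact: mlim|exact: bad0|].
  move=> x /= nx; apply: contrapT => xlim; apply: nx.
  have [k0 xk0] : exists k0, ~ B k0 x.
    by apply: contrapT => /forallNP xB; apply: xlim => k _; exact: contrapT (xB k).
  split => //.
  - move=> j k jk; apply: ler_pM => //; first by rewrite le_max lexx.
      rewrite ge_max !le_max lexx /= lerB// ?cS// orbT//.
    rewrite !indicE !in_setC ler_nat.
    case: (boolP (x \in B k)) => [/set_mem/(BS _ _ jk)/mem_set ->|_] //.
    exact: leq_b1.
  - apply/cvgrPdist_le => e e0; near=> k.
    have xk : ~ B k x.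
      by move=> /BS xk; apply: xk0; apply: xk; near: k; exact: nbhs_infty_ge.
    rewrite /u indicE in_setC memNset//= mulr1.
    have ck : c k <= e by near: k; exact: cvgc.
    have := c0 k; rewrite /Num.max /Order.max; case: ifPn; rewrite -?leNgt => ? ?.
      by rewrite opprB addrC subrK gtr0_norm.
    rewrite subr0 normr_id; lra.
apply: (@le_trans _ _ (N (fun x => `|h x|%R))).
  by apply: (le_bbfs_norm mabs mh) => x /=; rewrite normr_id.
rewrite -(cvg_lim (@ereal_hausdorff R) Ncvg); apply: lime_le.
  by apply/cvg_ex; exists (N (fun x => `|h x|)).
apply: nearW => k; have [_ _ _ GC _] := GW k; apply: le_trans GC.
exact: (le_bbfs_norm (mG k) (mu_ k)).
Unshelve. all: by end_near. Qed.

End ball_banach.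

(** * Approximation of a function by its means on the cubes of a grid *)

Section grid_approximation.
Context {R : realType} {n : nat} (X : ballBanachFunctionSpace R n).
Local Notation T := (lebesgue_rVType R n).
Local Notation mu := (lebesgue_rV R n).
Local Notation norm := (bbfs_norm X).
Variables (K : nat) (d : R).
Hypothesis d0 : 0 < d.
Local Notation I := {ffun 'I_n -> 'I_(K + K)}.
Implicit Types (f g : 'rV[R]_n -> R) (z : I) (x : 'rV[R]_n).

Definition grid_cube z : set T := cube (fun i => gridpt d z ord0 i) d.

Definition grid_cube_mean z f : R := cube_mean (fun i => gridpt d z ord0 i) d f.

(** The cubes being disjoint, at most one term is nonzero: this is [f] minus its local mean on the
    region covered by the grid, and 0 elsewhere. *)
Definition grid_oscillation f x : R :=
  \sum_z (f x - grid_cube_mean z f) * \1_(grid_cube z) x.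

Lemma measurable_grid_cube z : measurable (grid_cube z).
Proof. exact: measurable_cube. Qed.

(** In each direction a common point forces the two integer indices to differ by less than 1. *)
Lemma grid_cube_disjoint z z' x : grid_cube z x -> grid_cube z' x -> z = z'.
Proof.
move=> xz xz'; apply/ffunP => i; apply/val_inj => /=.
have lt_succ (p q : R) : (p - K%:R) * d <= x ord0 i -> x ord0 i < (q - K%:R) * d + d ->
    p < q + 1.
  move=> a b; have : (p - q - 1) * d < 0 by lra.
  by rewrite pmulr_llt0//; lra.
have := xz i; have := xz' i; rewrite !mxE => /andP[a b] /andP[a' b'].
apply/eqP; rewrite eqn_leq; apply/andP; split; rewrite -ltnS -(ltr_nat R) -natr1.
  exact: lt_succ a' b.
exact: lt_succ a b'.
Qed.

Lemma grid_cube_cover x : (forall i, `|x ord0 i| < K%:R * d) -> exists z, grid_cube z x.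
Proof.
move=> xK.
have xd i : - K%:R < x ord0 i / d < K%:R.
  have := xK i; rewrite ltr_norml => /andP[a b].
  by rewrite ltr_pdivlMr// mulNr a ltr_pdivrMr.
(* In direction [i] the cube has as index the integer part of this quotient, shifted by [K] to be
   nonnegative. *)
have tr i : (Num.truncn (x ord0 i / d + K%:R))%:R <= x ord0 i / d + K%:R <
    (Num.truncn (x ord0 i / d + K%:R)).+1%:R.
  by apply: truncn_itv; have /andP[] := xd i; lra.
have tK i : (Num.truncn (x ord0 i / d + K%:R) < K + K)%N.
  rewrite -(ltr_nat R) natrD; have /andP[? ?] := xd i; have /andP[? ?] := tr i; lra.
exists [ffun i => Ordinal (tK i)] => i; rewrite !mxE ffunE /=.
move: (tr i); rewrite -natr1; move: (Num.truncn _) => t /andP[a b].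
have dn0 : d != 0 by rewrite gt_eqF.
rewrite -[x ord0 i](divfK dn0) ler_pM2r// -[X in _ < _ + X]mul1r -mulrDl ltr_pM2r//.
by apply/andP; split; lra.
Qed.

Lemma sum_grid_cube (a : I -> R) z x : grid_cube z x ->
  \sum_z' a z' * \1_(grid_cube z') x = a z.
Proof.
move=> xz; rewrite (bigD1 z)//= indicE mem_set// mulr1 big1 ?addr0// => z' zz'.
rewrite indicE memNset ?mulr0// => xz'.
by rewrite (grid_cube_disjoint xz xz') eqxx in zz'.
Qed.

Lemma sum_grid_cube_out (a : I -> R) x : (forall z, ~ grid_cube z x) ->
  \sum_z a z * \1_(grid_cube z) x = 0.
Proof. by move=> xz; apply: big1 => z _; rewrite indicE memNset ?mulr0. Qed.

Lemma measurable_sum_grid_cube (a : I -> 'rV[R]_n -> R) :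
  (forall z, lebesgue_measurable_fun (a z)) ->
  lebesgue_measurable_fun (fun x => \sum_z a z x * \1_(grid_cube z) x).
Proof.
move=> ma; apply: measurable_sum => z; apply: (measurable_funM (ma z)).
exact: measurable_indic (measurable_grid_cube z).
Qed.

Lemma measurable_grid_oscillation f :
  lebesgue_measurable_fun f -> lebesgue_measurable_fun (grid_oscillation f).
Proof.
move=> mf; apply: (measurable_sum_grid_cube (a := fun z x => f x - grid_cube_mean z f)) => z.
by apply: (measurable_funB mf); exact: measurable_cst.
Qed.

(** The weights of the translates that fall in the cube add up to 1, so [f x] is the grid mean of
    the constant [f x]. The sums are then compared term by term, translates outside the cube
    contributing 0 to both. *)
Lemma grid_mean_deviation N z f x : (0 < N)%N -> grid_cube z x ->
  `|f x - grid_mean (fun i => gridpt d z ord0 i) d N f x| <=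
  N%:R ^- n * \sum_(j : {ffun 'I_n -> 'I_(N + N)}) `|translate f (gridpt (d / N%:R) j) x - f x|.
Proof.
move=> N0 xz.
have Nn0 : 0 <= N%:R ^- n :> R by rewrite invr_ge0 exprn_ge0.
rewrite -[X in `|X - _|]mulr1 -[X in _ * X - _](grid_mean_full d0 N0 xz).
rewrite /grid_mean mulrCA -mulrBr normrM (ger0_norm Nn0) ler_wpM2l//.
rewrite big_distrr /= -sumrB; apply: le_trans (ler_norm_sum _ _ _) _.
apply: ler_sum => j _; rewrite /translate /= !indicE.
case: (_ \in _); first by rewrite !mulr1 distrC.
by rewrite !mulr0 subrr normr0.
Qed.

(** On each cube, [f] minus its mean is [f] minus its grid mean, plus grid mean minus mean. The
    first part is dominated by [N ^- n] times a sum of [(2 N) ^ n] differences of norm at most [e];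
    the second is small in L^1 for large [N]. *)
Lemma bbfs_norm_grid_oscillation f (e : R) : lebesgue_measurable_fun f ->
  (forall z, (l1norm mu (grid_cube z) f < +oo)%E) ->
  (forall N (j : {ffun 'I_n -> 'I_(N + N)}), (0 < N)%N ->
     (norm (translate f (gridpt (d / N%:R) j) \- f)%R <= e%:E)%E) ->
  (norm (grid_oscillation f) <= (2 ^+ n * e)%:E)%E.
Proof.
move=> mf foo osc.
apply: bbfs_norm_le_l1_approx; first exact: measurable_grid_oscillation.
move=> r r0.
pose gm N z x := grid_mean (fun i => gridpt d z ord0 i) d N f x.
(* The L^1 error is shared among the cubes; the added 1 avoids a division by 0 when there are
   none. *)
pose q : R := #|{: I}|%:R + 1.
have q0 : 0 < q by rewrite ltr_wpDl.
have [N [N0 devN]] : exists N, (0 < N)%N /\ forall z,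
    (l1norm mu (grid_cube z) (fun x => gm N z x - grid_cube_mean z f)%R <= (r / q)%:E)%E.
  have cvgN : \forall N \near \oo, forall z,
      (l1norm mu (grid_cube z) (fun x => gm N z x - grid_cube_mean z f)%R <= (r / q)%:E)%E.
    apply: filter_forall => z.
    exact: (grid_mean_cvg d0 mf (foo z) (divr_gt0 r0 q0)).
  have [m _ H] := filterI (nbhs_infty_gt 0) cvgN.
  by exists m; exact: (H m (leqnn m)).
have mdev z : lebesgue_measurable_fun (fun x => gm N z x - grid_cube_mean z f).
  by apply: measurable_funB; [exact: measurable_grid_mean mf|exact: measurable_cst].
have mv (j : {ffun 'I_n -> 'I_(N + N)}) :
    lebesgue_measurable_fun (translate f (gridpt (d / N%:R) j) \- f).
  exact: (measurable_funB (measurable_translate _ mf) mf).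
have mabs g : lebesgue_measurable_fun g -> lebesgue_measurable_fun (fun x => `|g x|).
  by move=> mg; exact: (measurableT_comp (@normr_measurable R setT) mg).
pose S x := \sum_(j : {ffun 'I_n -> 'I_(N + N)}) `|translate f (gridpt (d / N%:R) j) x - f x|.
have mS : lebesgue_measurable_fun S by apply: measurable_sum => j; exact: mabs (mv j).
exists (fun x => N%:R ^- n * S x).
exists (fun x => \sum_z `|gm N z x - grid_cube_mean z f| * \1_(grid_cube z) x).
have Nn0 : 0 < N%:R ^- n :> R by rewrite invr_gt0 exprn_gt0// ltr0n.
split.
- exact: (measurable_funM (measurable_cst _) mS).
- apply: (measurable_sum_grid_cube (a := fun z x => `|gm N z x - grid_cube_mean z f|)) => z.
  exact: mabs (mdev z).
- move=> x; split; first by apply: sumr_ge0 => z _; rewrite mulr_ge0.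
  have [[z xz]|nz] := pselect (exists z, grid_cube z x); last first.
    rewrite /grid_oscillation !sum_grid_cube_out ?normr0 ?addr0// => z xz;
    by apply: nz; exists z.
  rewrite /grid_oscillation !(sum_grid_cube _ xz).
  have Sx : 0 <= S x by apply: sumr_ge0.
  rewrite [X in _ <= X + _]ger0_norm ?mulr_ge0 ?(ltW Nn0)//.
  rewrite -[f x](subrK (gm N z x)) -addrA; apply: le_trans (ler_normD _ _) _.
  by rewrite lerD2r; exact: grid_mean_deviation.
- apply: le_trans (bbfs_normZ_le _ Nn0 mS) _.
  apply: (@le_trans _ _ ((N%:R ^- n)%:E * \sum_(j : {ffun 'I_n -> 'I_(N + N)}) e%:E)%E).
    apply: lee_wpmul2l; first by rewrite lee_fin ltW.
    apply: le_trans (bbfs_norm_sum X _ _) _; first by move=> j; exact: mabs (mv j).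
    apply: lee_sum => j _; apply: le_trans (osc N j N0).
    by apply: (le_bbfs_norm X (mv j) (mabs _ (mv j))) => x; rewrite normr_id.
  rewrite sumEFin -EFinM lee_fin sumr_const card_ffun !card_ord.
  rewrite -[e *+ _]mulr_natl mulrA natrX natrD -exprVn -exprMn mulrDr mulVf//.
  by rewrite pnatr_eq0 -lt0n.
- under eq_integral do rewrite -sumEFin.
  rewrite (ge0_integral_sum _ measurableT).
  + apply: (@le_trans _ _ (\sum_(z : I) (r / q)%:E)%E).
      apply: lee_sum => z _; apply: le_trans (devN z).
      rewrite l1norm_restrict; apply: ge0_le_integral.
      * exact: measurableT.
      * by move=> x _; rewrite lee_fin mulr_ge0.
      * apply/measurable_EFinP; apply: (measurable_funM (mabs _ (mdev z))).
        exact: measurable_indic (measurable_grid_cube z).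
      * apply: measurable_normr_EFin; apply: (measurable_funM (mdev z)).
        exact: measurable_indic (measurable_grid_cube z).
      * by move=> x _; rewrite lee_fin normrM [X in _ <= _ * X]ger0_norm.
    rewrite sumEFin lee_fin sumr_const -[_ *+ _]mulr_natl mulrA ler_pdivrMr// mulrC.
    by rewrite ler_pM2l// /q lerDl.
  + move=> z; apply/measurable_EFinP; apply: (measurable_funM (mabs _ (mdev z))).
    exact: measurable_indic (measurable_grid_cube z).
  + by move=> z x _; rewrite lee_fin mulr_ge0.
Qed.

End grid_approximation.

(** * Euclidean norm against coordinates, and measurability of balls *)

Section euclidean_norm.
Context {R : realType} {n : nat}.
Implicit Types x y : 'rV[R]_n.

Lemma ler_coord_euclidean x i : `|x ord0 i| <= euclidean_norm x.
Proof.
rewrite -sqrtr_sqr /euclidean_norm ler_wsqrtr// (bigD1 i)//= lerDl.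
by apply: sumr_ge0 => j _; exact: sqr_ge0.
Qed.

Lemma euclidean_norm_le x (c : R) : (forall i, `|x ord0 i| <= c) -> 0 <= c ->
  euclidean_norm x <= n%:R * c.
Proof.
move=> xc c0; rewrite -[leRHS](@ger0_norm _ (n%:R * c)) ?mulr_ge0// -sqrtr_sqr.
apply: ler_wsqrtr; apply: (@le_trans _ _ (\sum_(i < n) c ^+ 2)).
  by apply: ler_sum => i _; rewrite -real_normK ?num_real// lerXn2r ?nnegrE.
rewrite sumr_const card_ord -[c ^+ 2 *+ n]mulr_natl exprMn ler_wpM2r ?sqr_ge0//.
by case: (n) => [|m]; rewrite ?expr0n// expr2 ler_peMr// ler1n.
Qed.

Lemma euclidean_ball0 (r : R) : euclidean_ball (0 : 'rV[R]_n) r = [set x | euclidean_norm x < r].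
Proof. by apply/seteqP; split => x; rewrite /euclidean_ball /= subr0. Qed.

Variable X : ballBanachFunctionSpace R n.
Local Notation T := (lebesgue_rVType R n).

(** The indicator of a ball of positive radius belongs to [X], and elements of [X] are measurable;
    other balls are empty. *)
Lemma measurable_euclidean_ball x (r : R) : measurable (euclidean_ball x r : set T).
Proof.
have [r0|r0] := ltP 0 r.
  by apply/(measurable_indicP R); exact: bbfs_measurable (bbfs_ball X x r0).
rewrite (_ : euclidean_ball x r = set0); first exact: measurable0.
by rewrite -subset0 => y /= /lt_le_trans/(_ r0); rewrite ltNge sqrtr_ge0.
Qed.

Lemma measurable_euclidean_norm_gt (M : R) :
  measurable ([set x | M < euclidean_norm x] : set T).
Proof.
rewrite (_ : mkset _ = \bigcup_k ~` (euclidean_ball 0 (M + k.+1%:R^-1) : set T)).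
  by apply: bigcupT_measurable => k; apply: measurableC; exact: measurable_euclidean_ball.
apply/seteqP; split => [x /= /ltr_add_invr[k Mk]|x [k _]].
  by exists k => //; rewrite euclidean_ball0 /=; apply/negP; rewrite -leNgt ltW.
rewrite euclidean_ball0 /= => /negP; rewrite -leNgt; apply: lt_le_trans.
by rewrite ltrDl invr_gt0.
Qed.

End euclidean_norm.

(** * Finite nets for bounded families of coordinates *)

Section pigeonhole.
Context {R : realType} {T : Type} {I : finType}.

(** Cut [-B, B] into slices of length [e] and label each [f] by the slices of its coordinates. There
    are finitely many labels, and one representative in [F] is kept for each label that occurs. *)
Lemma bounded_coordinates_net (F : set T) (c : T -> I -> R) (B e : R) : 0 < e ->
  (forall f i, F f -> `|c f i| <= B) ->
  exists G : set T, [/\ finite_set G, G `<=` F &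
    forall f, F f -> exists2 g, G g & forall i, `|c f i - c g i| <= e].
Proof.
move=> e0 cB.
pose m := Num.truncn ((B + B) / e).
pose code f : {ffun I -> 'I_m.+1} := [ffun i => inord (Num.truncn ((c f i + B) / e))].
have codeP f g i : F f -> F g -> code f = code g -> `|c f i - c g i| <= e.
  move=> Ff Fg /ffunP/(_ i)/(congr1 (@nat_of_ord _)); rewrite !ffunE.
  have pos h : F h -> 0 <= (c h i + B) / e.
    by move=> /cB - /(_ i); rewrite ler_norml => /andP[? ?]; apply: divr_ge0; [lra|exact: ltW].
  have tm h : F h -> (Num.truncn ((c h i + B) / e) < m.+1)%N.
    move=> /cB - /(_ i); rewrite ler_norml => /andP[? ?].
    by rewrite ltnS le_truncn// ler_pM2r ?invr_gt0//; lra.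
  rewrite !inordK ?tm// => fg.
  have := truncn_itv (pos f Ff); have := truncn_itv (pos g Fg); rewrite fg -natr1.
  move: (Num.truncn _)%:R => t /andP[]; rewrite ler_pdivlMr// ltr_pdivrMr// => a b.
  move=> /andP[]; rewrite ler_pdivlMr// ltr_pdivrMr// => a' b'.
  rewrite ler_norml; lra.
have [[f0 Ff0]|F0] := pselect (exists f, F f); last first.
  by exists set0; split => // f Ff; case: F0; exists f.
pose D := [set u : {ffun I -> 'I_m.+1} | exists2 f, F f & code f = u].
(* [f0] is only the default for labels that do not occur. *)
have /choice[r rP] u : exists f, D u -> F f /\ code f = u.
  by have [[f Ff fu]|nD] := pselect (D u); [exists f|exists f0].
exists (r @` D); split.
- by apply: finite_image; exact: finite_finset.
- by move=> _ [u Du <-]; have [] := rP u Du.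
- move=> f Ff; have Df : D (code f) by exists f.
  have [Fr rf] := rP _ Df; exists (r (code f)); first by exists (code f).
  by move=> i; apply: codeP.
Qed.

End pigeonhole.

(** * Sufficiency of the three conditions *)

Section compactness_criterion.
Context {R : realType} {n : nat} (X : ballBanachFunctionSpace R n).
Local Notation T := (lebesgue_rVType R n).
Local Notation mu := (lebesgue_rV R n).
Local Notation norm := (bbfs_norm X).
Implicit Types (f g h : 'rV[R]_n -> R) (F : set ('rV[R]_n -> R)).

Lemma bbfs_normD_le f g (a b : R) :
  lebesgue_measurable_fun f -> lebesgue_measurable_fun g ->
  (norm f <= a%:E)%E -> (norm g <= b%:E)%E -> (norm (fun x => f x + g x)%R <= (a + b)%:E)%E.
Proof.
move=> mf mg fa gb; apply: le_trans (bbfs_normD X mf mg) _.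
by rewrite EFinD; exact: leeD.
Qed.

Lemma bbfs_bounded_ge0 F : bbfs_bounded X F ->
  exists2 S : R, 0 <= S & forall f, F f -> (norm f <= S%:E)%E.
Proof.
rewrite /bbfs_bounded => supF.
have ub f : F f -> (norm f <= ereal_sup [set norm f | f in F])%E.
  by move=> Ff; apply: ereal_sup_ubound; exists f.
move: supF ub; case: (ereal_sup _) => [s| |] // _ ub.
  exists (Num.max 0 s); first by rewrite le_max lexx.
  by move=> f /ub /le_trans; apply; rewrite lee_fin le_max lexx orbT.
(* The supremum is -oo when [F] is empty. *)
by exists 0 => // f /ub /le_trans; apply; rewrite leNye.
Qed.

Lemma gridpt_coord N (d : R) (j : {ffun 'I_n -> 'I_(N + N)}) i : 0 <= d ->
  `|gridpt d j ord0 i| <= N%:R * d.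
Proof.
move=> d0; rewrite mxE normrM [X in _ * X]ger0_norm// ler_wpM2r//.
have := ltn_ord (j i); rewrite -(ltr_nat R) natrD => jN.
have : 0 <= (j i)%:R :> R by [].
by rewrite ler_norml; lra.
Qed.

Lemma grid_cube_coord K (d : R) (z : {ffun 'I_n -> 'I_(K + K)}) (x : 'rV[R]_n) i :
  0 < d -> grid_cube d z x -> `|x ord0 i| <= K%:R * d.
Proof.
move=> d0 /(_ i); rewrite !mxE => /andP[a b].
have jK : (z i)%:R + 1 <= K%:R + K%:R :> R by rewrite natr1 -natrD ler_nat ltn_ord.
have z0 : 0 <= (z i)%:R :> R by [].
have : ((z i)%:R + 1 - (K%:R + K%:R)) * d <= 0 by rewrite pmulr_lle0// subr_le0.
have : 0 <= (z i)%:R * d by rewrite mulr_ge0// ltW.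
by rewrite ler_norml; lra.
Qed.

Lemma compactness_criterion F : F `<=` bbfs_space X -> bbfs_bounded X F ->
  uniformly_vanishes_at_infinity X F -> uniformly_equicontinuous X F ->
  bbfs_totally_bounded X F.
Proof.
move=> FX /bbfs_bounded_ge0[S S0 FS] vanish equi eps eps0.
have mF f : F f -> lebesgue_measurable_fun f by move=> /FX/bbfs_measurable.
have p0 : 0 < 2 ^+ n :> R by rewrite exprn_gt0.
(* The final bound is [(2 ^ n + 2 ^ n + 3) * e]; the constant 4 makes it strictly less than
   [eps]. *)
pose e : R := eps / (2 ^+ n + 2 ^+ n + 4).
have e0 : 0 < e by rewrite divr_gt0//; lra.
have [M M0 FM] := vanish e e0; have [rho rho0 Frho] := equi e e0.
(* Grid shifts have coordinates at most [d], hence Euclidean norm at most [n * d < rho]. *)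
pose d : R := rho / n.+1%:R.
have d0 : 0 < d by rewrite divr_gt0.
(* Enough cubes to cover all points of norm at most [M]. *)
pose K := (Num.truncn (M / d)).+1.
have MK : M < K%:R * d by rewrite -ltr_pdivrMr// truncnS_gt.
pose I := {ffun 'I_n -> 'I_(K + K)}.
pose r : R := n%:R * (K%:R * d) + 1.
have Kd0 : 0 <= K%:R * d by rewrite mulr_ge0// ltW.
have r0 : 0 < r by rewrite ltr_wpDl// mulr_ge0.
have cube_ball (z : I) : grid_cube d z `<=` (euclidean_ball 0 r : set T).
  move=> x zx; rewrite euclidean_ball0 /=.
  apply: (@le_lt_trans _ _ (n%:R * (K%:R * d))); last by rewrite ltrDl.
  by apply: euclidean_norm_le => // i; exact: grid_cube_coord zx.
have mball := measurable_euclidean_ball X 0 r.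
(* Local integrability on a ball containing all cubes turns the bound [S] in [X] into a bound for
   the means. *)
have [C C0 ballC] := bbfs_integral X 0 r0.
have l1C f (z : I) : F f -> (l1norm mu (grid_cube d z) f <= (C * S)%:E)%E.
  move=> Ff; apply: (@le_trans _ _ (C%:E * norm f)%E).
    apply: le_trans (ballC f (FX _ Ff)); apply: ge0_subset_integral.
    - exact: measurable_grid_cube.
    - exact: mball.
    - exact: measurable_normr_EFin (mF _ Ff).
    - by move=> x _; rewrite lee_fin.
    - exact: cube_ball.
  by rewrite EFinM; apply: lee_wpmul2l (FS f Ff); rewrite lee_fin ltW.
have l1oo f (z : I) : F f -> (l1norm mu (grid_cube d z) f < +oo)%E.
  by move=> Ff; apply: le_lt_trans (l1C f z Ff) _; rewrite ltry.
have meanB f (z : I) : F f -> `|grid_cube_mean d z f| <= C * S / d ^+ n.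
  move=> Ff; rewrite ler_pdivlMr ?exprn_gt0// -lee_fin EFinM.
  rewrite -(lebesgue_cube (fun i => gridpt d z ord0 i) d0).
  apply: le_trans (cube_mean_bound d0 (mF f Ff) (l1oo f z Ff)) _.
  exact: l1C.
have mcube (z : I) : lebesgue_measurable_fun (\1_(grid_cube d z)).
  exact: measurable_indic (measurable_grid_cube d z).
have cubeX (z : I) : norm \1_(grid_cube d z) \is a fin_num.
  rewrite ge0_fin_numE ?bbfs_norm_ge0//.
  apply: le_lt_trans (bbfs_norm_fin (bbfs_ball X 0 r0)).
  apply: (le_bbfs_norm X (bbfs_measurable (bbfs_ball X 0 r0)) (mcube z)) => x.
  rewrite !indicE; case: (boolP (x \in grid_cube d z)) => [/set_mem/cube_ball xb|_].
    by rewrite mem_set.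
  by rewrite normr0.
pose A : R := \sum_(z : I) fine (norm \1_(grid_cube d z)).
have A0 : 0 <= A by apply: sumr_ge0 => z _; rewrite fine_ge0// bbfs_norm_ge0.
(* An error [eta] in every mean costs at most [eta * A <= e] in [X]; the added 1 avoids a division
   by 0. *)
pose eta := e / (A + 1).
have eta0 : 0 < eta by rewrite divr_gt0// ltr_wpDl.
have [G [Gfin GF net]] := bounded_coordinates_net
  (c := fun f (z : I) => grid_cube_mean d z f) eta0 (fun f z Ff => meanB f z Ff).
have osc f : F f -> (norm (fun x => `|grid_oscillation K d f x|%R) <= (2 ^+ n * e)%:E)%E.
  move=> Ff; have mo := measurable_grid_oscillation K d (mF f Ff).
  apply: (@le_trans _ _ (norm (grid_oscillation K d f))).
    apply: (le_bbfs_norm X mo); last by move=> x; rewrite normr_id.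
    exact: (measurableT_comp (@normr_measurable R setT) mo).
  apply: (bbfs_norm_grid_oscillation d0 (mF f Ff)) => [z|N j N0]; first exact: l1oo.
  apply/ltW/Frho => //.
  apply: (@le_lt_trans _ _ (n%:R * d)); last first.
    by rewrite /d mulrCA gtr_pMr// ltr_pdivrMr// mul1r ltr_nat.
  apply: euclidean_norm_le; last exact: ltW.
  move=> i; apply: le_trans (gridpt_coord _ _ _) _; first by rewrite divr_ge0// ltW.
  by rewrite mulrCA mulfV ?mulr1// pnatr_eq0 -lt0n.
pose tail f x := `|f x * \1_[set x | M < euclidean_norm x] x|.
have mgt := measurable_euclidean_norm_gt X M.
have mtail0 f : F f -> lebesgue_measurable_fun (f \* \1_[set x | M < euclidean_norm x]).
  by move=> Ff; apply: (measurable_funM (mF f Ff)); exact: measurable_indic.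
have mtail f : F f -> lebesgue_measurable_fun (tail f).
  by move=> Ff; exact: (measurableT_comp (@normr_measurable R setT) (mtail0 f Ff)).
have tailN f : F f -> (norm (tail f) <= e%:E)%E.
  move=> Ff; apply: le_trans (ltW (FM f Ff)).
  by apply: (le_bbfs_norm X (mtail0 f Ff) (mtail f Ff)) => x; rewrite normr_id.
pose step x := \sum_(z : I) eta * \1_(grid_cube d z) x.
have mstep : lebesgue_measurable_fun step.
  by apply: (@measurable_sum_grid_cube R n K d (fun _ _ => eta)) => z; exact: measurable_cst.
have stepN : (norm step <= e%:E)%E.
  apply: le_trans (bbfs_norm_sum X _ _) _.
    by move=> z; apply: (measurable_funM (measurable_cst _)); exact: mcube.
  apply: (@le_trans _ _ (\sum_(z : I) (eta * fine (norm \1_(grid_cube d z)))%:E)%E).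
    apply: lee_sum => z _; apply: le_trans (bbfs_normZ_le X eta0 (mcube z)) _.
    by rewrite [leRHS]EFinM fineK.
  rewrite sumEFin lee_fin -mulr_sumr -/A /eta mulrAC ler_pdivrMr ?ltr_wpDl//.
  by rewrite ler_pM2l// lerDl.
exists G; split => // f Ff; have [g Gg fg] := net f Ff; exists g => //.
have Fg := GF g Gg.
have mosc h : F h -> lebesgue_measurable_fun (fun x => `|grid_oscillation K d h x|).
  move=> Fh; have mo := measurable_grid_oscillation K d (mF h Fh).
  exact: (measurableT_comp (@normr_measurable R setT) mo).
(* [H] dominates [f - g]. On a cube, the difference is made of the two oscillations and a difference
   of means, at most [eta]; off the cubes the norm of [x] exceeds [M] and both functions equal their
   tails. *)
pose H x := `|grid_oscillation K d f x| + (`|grid_oscillation K d g x| +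
  (step x + (tail f x + tail g x))).
have m1 := measurable_funD (mtail f Ff) (mtail g Fg).
have m2 := measurable_funD mstep m1.
have m3 := measurable_funD (mosc g Fg) m2.
have mH : lebesgue_measurable_fun H := measurable_funD (mosc f Ff) m3.
have HN : (norm H <= (2 ^+ n * e + (2 ^+ n * e + (e + (e + e))))%:E)%E.
  apply: (bbfs_normD_le (mosc f Ff) m3 (osc f Ff)).
  apply: (bbfs_normD_le (mosc g Fg) m2 (osc g Fg)).
  apply: (bbfs_normD_le mstep m1 stepN).
  exact: (bbfs_normD_le (mtail f Ff) (mtail g Fg) (tailN f Ff) (tailN g Fg)).
apply: (@le_lt_trans _ _ (norm H)).
  apply: (le_bbfs_norm X mH (measurable_funB (mF f Ff) (mF g Fg))) => x /=.
  have step0 : 0 <= step x by apply: sumr_ge0 => z _; rewrite mulr_ge0// ltW.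
  have tf : 0 <= tail f x by exact: normr_ge0.
  have tg : 0 <= tail g x by exact: normr_ge0.
  have H0 : 0 <= H x by rewrite /H !addr_ge0.
  rewrite (ger0_norm H0) /H.
  have [[z xz]|nz] := pselect (exists z : I, grid_cube d z x).
    rewrite /grid_oscillation /step !(sum_grid_cube d0 _ xz).
    have := fg z.
    rewrite -[f x - g x](_ : (f x - grid_cube_mean d z f) - (g x - grid_cube_mean d z g) +
      (grid_cube_mean d z f - grid_cube_mean d z g) = _); last by ring.
    move=> fgz; apply: le_trans (ler_normD _ _) _.
    apply: le_trans (lerD (ler_normB _ _) fgz) _.
    by rewrite -!addrA !lerD2l lerDl addr_ge0.
  have nz' (z : I) : ~ grid_cube d z x by move=> xz; apply: nz; exists z.
  have xM : M < euclidean_norm x.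
    apply: contrapT => /negP; rewrite -leNgt => xM; apply: nz.
    apply: (grid_cube_cover d0) => i.
    by apply: le_lt_trans (ler_coord_euclidean x i) _; exact: le_lt_trans xM MK.
  rewrite /grid_oscillation /step !sum_grid_cube_out// !normr0 !add0r.
  rewrite /tail indicE mem_set// !mulr1; exact: ler_normB.
apply: le_lt_trans HN _; rewrite lte_fin.
rewrite [X in _ < X](_ : _ = (2 ^+ n + 2 ^+ n + 4) * e); first by lra.
by rewrite /e mulrCA mulfV ?mulr1// gt_eqF//; lra.
Qed.

End compactness_criterion.

(** * Uniform estimates for continuous functions with compact support *)

Section compact_support.
Context {R : realType} {n : nat}.
Implicit Types (x xi : 'rV[R]_n) (h : 'rV[R]_n -> R).

(** [P] is upward closed in the radius, so a maximum over the finite set works; starting it at 1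
    makes it positive, even for empty [G]. *)
Lemma finite_set_uniform_radius (T : Type) (G : set T) (P : T -> R -> Prop) :
  finite_set G -> (forall g r s, r <= s -> P g r -> P g s) ->
  (forall g, G g -> exists r, P g r) ->
  exists2 r, 0 < r & forall g, G g -> P g r.
Proof.
move=> finG mono exr.
have /choice[r rP] g : exists r, G g -> P g r.
  by have [/exr[r Pr]|nG] := pselect (G g); [exists r|exists 0].
have /finite_seqP[s sE] := finite_image r finG.
exists (\big[Num.max/1]_(t <- s) t).
  by apply: lt_le_trans (bigmax_ge_id _ _ _ _); exact: ltr01.
move=> g Gg; apply: mono (rP g Gg); apply: le_bigmax_seq => //.
have rg : (r @` G) (r g) by exists g.
by rewrite sE in rg.
Qed.

Lemma ler_coord_norm x i : `|x ord0 i| <= `|x|.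
Proof. by rewrite [leRHS]mx_normrE; exact: (le_bigmax _ _ (ord0, i)). Qed.

Lemma compact_support_bounded h : continuous_compact_support h ->
  exists2 M : R, 0 < M & forall x, h x != 0 -> forall i, `|x ord0 i| <= M.
Proof.
move=> [_ /compact_bounded[M [_ HM]]].
exists (Num.max 1 (M + 1)); first by rewrite lt_max ltr01.
move=> x hx i; apply: le_trans (ler_coord_norm x i) _.
apply: HM; first by rewrite lt_max ltrDl ltr01 orbT.
exact: subset_closure.
Qed.

(** Compactness gives a radius valid for all [x] in the closed support. If only [x + xi] lies there,
    the estimate is used at that point with [- xi]; if neither does, both values vanish. *)
Lemma compact_support_uniform h (eta : R) : continuous_compact_support h -> 0 < eta ->
  exists2 rho : R, 0 < rho & forall x xi, euclidean_norm xi < rho ->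
    `|h (x + xi) - h x| <= eta.
Proof.
move=> [ch Kh] eta0.
pose K := closure [set x | h x != 0].
have K0 x : ~ K x -> h x = 0.
  by move=> Kx; apply: contrapT => /eqP hx; apply: Kx; exact: subset_closure.
have /compact_near_coveringP cover := Kh.
have /nbhs_ballP[rho /= rho0 Hrho] : \forall xi \near (0 : 'rV[R]_n),
    K `<=` [set x | `|h (x + xi) - h x| <= eta].
  (* The estimate is required jointly for points near [x] and small [xi]; both values are compared
     with [h x]. *)
  refine (cover _ (nbhs (0 : 'rV[R]_n)) (fun xi x => `|h (x + xi) - h x| <= eta) _ _) => x Kx.
  have e20 : 0 < eta / 2 by exact: divr_gt0.
  have hx : \forall y \near x, `|h x - h y| < eta / 2.
    by have /cvgrPdist_lt/(_ _ e20) := ch x.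
  have hx' : \forall p \near (x, (0 : 'rV[R]_n)), `|h x - h (p.1 + p.2)| < eta / 2.
    have addc : p.1 + p.2 @[p --> (x, (0 : 'rV[R]_n))] --> x.
      by rewrite -[X in _ --> X](addr0 x); exact: (@add_continuous 'rV[R]_n (x, 0)).
    exact: (addc _ hx).
  have hx2 : \forall p \near (x, (0 : 'rV[R]_n)), `|h x - h p.1| < eta / 2.
    exact: (cvg_fst hx).
  apply: filterS2 hx' hx2 => p; rewrite /= distrC => a b.
  rewrite -[h _](subrK (h x)) -addrA [eta]splitr.
  by apply: le_trans (ler_normD _ _) _; rewrite lerD// ltW.
(* The topology is that of the maximum norm, which the Euclidean norm dominates. *)
have small xi : euclidean_norm xi < rho -> ball (0 : 'rV[R]_n) rho xi.
  move=> xirho; split=> [|i j]; first exact: rho0.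
  rewrite /ball /= mxE sub0r normrN (ord1 i).
  exact: le_lt_trans (ler_coord_euclidean _ _) xirho.
exists rho => // x xi xirho.
have [Kx|Kx] := pselect (K x); first exact: (Hrho _ (small _ xirho)).
have [Kxi|Kxi] := pselect (K (x + xi)); last first.
  by rewrite !K0// subrr normr0 ltW.
have xirhoN : euclidean_norm (- xi) < rho.
  by rewrite /euclidean_norm; under eq_bigr do rewrite mxE sqrrN.
by have := Hrho _ (small _ xirhoN) _ Kxi; rewrite /= addrK distrC.
Qed.

End compact_support.

(** * Necessity of the three conditions *)

Section necessity.
Context {R : realType} {n : nat} (X : ballBanachFunctionSpace R n).
Local Notation norm := (bbfs_norm X).
Implicit Types (f g h : 'rV[R]_n -> R) (xi : 'rV[R]_n) (F : set ('rV[R]_n -> R)).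

Hypothesis dense : bbfs_dense X continuous_compact_support.
Hypothesis tinv : translation_invariant X.

Let mX f : bbfs_space X f -> lebesgue_measurable_fun f := @bbfs_measurable _ _ X f.

Let tail_set (M : R) : set 'rV[R]_n := [set x | M < euclidean_norm x].

Let mtail f (M : R) : bbfs_space X f -> lebesgue_measurable_fun (f \* \1_(tail_set M)).
Proof.
move=> Xf; apply: (measurable_funM (mX Xf)); apply: measurable_indic.
exact: measurable_euclidean_norm_gt X M.
Qed.

Lemma bbfs_spaceB f g : bbfs_space X f -> bbfs_space X g -> bbfs_space X (f \- g).
Proof.
move=> Xf Xg; rewrite (_ : f \- g = f \+ (-1 \*o g)).
  by apply: bbfs_spaceD => //; exact: bbfs_spaceZ.
by apply/funext => x /=; rewrite mulN1r.
Qed.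

Lemma bbfs_norm_tail_le f (M : R) : bbfs_space X f ->
  (norm (f \* \1_(tail_set M))%R <= norm f)%E.
Proof.
move=> Xf; apply: (le_bbfs_norm X (mX Xf) (mtail M Xf)) => x /=.
by rewrite indicE; case: (_ \in _); rewrite ?mulr1// mulr0 normr0.
Qed.

Lemma bbfs_norm_tail_approx f g (M : R) : bbfs_space X f -> bbfs_space X g ->
  (norm (f \* \1_(tail_set M))%R <= norm (f \- g)%R + norm (g \* \1_(tail_set M))%R)%E.
Proof.
move=> Xf Xg; have Xfg := bbfs_spaceB Xf Xg.
apply: le_trans (leeD (bbfs_norm_tail_le M Xfg) (lexx _)).
apply: le_trans (bbfs_normD X (mtail M Xfg) (mtail M Xg)).
rewrite le_eqVlt; apply/orP; left; apply/eqP; congr (norm _).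
by apply/funext => x /=; rewrite -mulrDl subrK.
Qed.

Lemma bbfs_norm_tail_small g (e : R) : bbfs_space X g -> 0 < e ->
  exists M, (norm (g \* \1_(tail_set M))%R < e%:E)%E.
Proof.
move=> Xg e0; have [DX /(_ g Xg e e0)[h Dh gh]] := dense.
have [M M0 hM] := compact_support_bounded Dh.
(* Points where [h] is nonzero have coordinates at most [M], hence Euclidean norm at most [n * M],
   so [h] has no tail beyond that radius. *)
exists (n%:R * M); apply: le_lt_trans (bbfs_norm_tail_approx _ Xg (DX _ Dh)) _.
rewrite (_ : h \* _ = fun=> 0) ?bbfs_norm0 ?adde0//.
apply/funext => x /=; rewrite indicE; case: (boolP (x \in _)) => [|_]; last by rewrite mulr0.
rewrite inE /tail_set /= mulr1 ltNge => xM; apply: contrapT => /eqP hx.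
by move/negP: xM; apply; apply: euclidean_norm_le; [exact: hM|exact: ltW].
Qed.

(** Invariance makes the norm of the translate finite, and functions outside [X] have norm +oo. *)
Lemma translate_space f xi : bbfs_space X f -> bbfs_space X (translate f xi).
Proof. by move=> Xf; apply: bbfs_mem; rewrite -tinv// bbfs_norm_fin. Qed.

(** The difference is the translate of [f - g], plus the difference for [g], plus [g - f];
    invariance removes the translation from the first term. *)
Lemma bbfs_norm_translate_approx f g xi : bbfs_space X f -> bbfs_space X g ->
  (norm (translate f xi \- f)%R <=
   norm (f \- g)%R + (norm (translate g xi \- g)%R + norm (f \- g)%R))%E.
Proof.
move=> Xf Xg; have Xfg := bbfs_spaceB Xf Xg; have Xgf := bbfs_spaceB Xg Xf.
have Xtg := bbfs_spaceB (translate_space xi Xg) Xg.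
rewrite {1}(tinv xi Xfg) [X in (_ <= _ + (_ + X))%E](bbfs_normB_sym X (mX Xf) (mX Xg)).
apply: le_trans (leeD (lexx _) (bbfs_normD X (mX Xtg) (mX Xgf))).
apply: le_trans (bbfs_normD X (mX (translate_space xi Xfg)) (mX (bbfs_spaceD Xtg Xgf))).
rewrite le_eqVlt; apply/orP; left; apply/eqP; congr (norm _).
by apply/funext => x; rewrite /translate /=; ring.
Qed.

(** For shifts of norm at most 1 the difference vanishes outside a fixed ball, and it is uniformly
    small on it. Smallness of [xi] is expressed through an inverse radius [r], so that the statement
    is upward closed in [r]. *)
Lemma compact_support_translate_small h (e : R) : continuous_compact_support h -> 0 < e ->
  exists r, forall xi, euclidean_norm xi * r < 1 -> (norm (translate h xi \- h)%R <= e%:E)%E.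
Proof.
move=> Dh e0; have [M M0 hM] := compact_support_bounded Dh.
pose r : R := n%:R * (M + 1) + 1.
have M10 : 0 <= M + 1 by rewrite addr_ge0// ltW.
have r0 : 0 < r by rewrite ltr_wpDl// mulr_ge0.
have Xb := bbfs_ball X (0 : 'rV[R]_n) r0.
pose b := fine (norm \1_(euclidean_ball 0 r)).
have b0 : 0 <= b by rewrite fine_ge0// bbfs_norm_ge0.
have b10 : 0 < b + 1 by rewrite ltr_wpDl.
pose eta := e / (b + 1).
have eta0 : 0 < eta by rewrite divr_gt0.
have [rho rho0 Hrho] := compact_support_uniform Dh eta0.
have Xh := dense.1 _ Dh.
(* This inverse radius forces both norm at most 1 and norm less than [rho]. *)
exists (1 + rho^-1) => xi; rewrite mulrDr mulr1 => xir.
have xi0 : 0 <= euclidean_norm xi by exact: sqrtr_ge0.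
have xir0 : 0 <= euclidean_norm xi * rho^-1 by rewrite mulr_ge0// invr_ge0 ltW.
have xi1 : euclidean_norm xi <= 1 by lra.
have xirho : euclidean_norm xi < rho by rewrite -[rho]mul1r -ltr_pdivrMr//; lra.
apply: (@le_trans _ _ (norm (fun x => eta * \1_(euclidean_ball 0 r) x)%R)).
  have mb := mX Xb.
  apply: (le_bbfs_norm X (measurable_funM (measurable_cst eta) mb)).
    exact: mX (bbfs_spaceB (translate_space xi Xh) Xh).
  move=> x /=; rewrite /translate indicE euclidean_ball0.
  have [xr|xr] := boolP (x \in _).
    by rewrite mulr1 (gtr0_norm eta0); exact: Hrho.
  have notsmall : ~ (forall i, `|x ord0 i| <= M + 1).
    move=> /euclidean_norm_le/(_ M10) xM; move/negP: xr; apply.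
    by apply/mem_set => /=; apply: le_lt_trans xM _; rewrite ltrDl.
  have h0 : h x = 0.
    apply: contrapT => /eqP/hM hx; apply: notsmall => i.
    by apply: le_trans (hx i) _; rewrite lerDl.
  have hxi0 : h (x + xi) = 0.
    apply: contrapT => /eqP/hM hx; apply: notsmall => i.
    have := hx i; have := le_trans (ler_coord_euclidean xi i) xi1.
    rewrite mxE !ler_norml => /andP[? ?] /andP[? ?]; apply/andP; split; lra.
  by rewrite h0 hxi0 subrr mulr0.
apply: le_trans (bbfs_normZ_le X eta0 (mX Xb)) _.
rewrite -[X in (_ * X)%E]fineK ?ge0_fin_numE ?bbfs_norm_ge0 ?bbfs_norm_fin//.
rewrite -/b -EFinM lee_fin /eta mulrAC ler_pdivrMr// ler_pM2l// lerDl.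
by [].
Qed.

Lemma bbfs_translate_small g (e : R) : bbfs_space X g -> 0 < e ->
  exists r, forall xi, euclidean_norm xi * r < 1 -> (norm (translate g xi \- g)%R < e%:E)%E.
Proof.
move=> Xg e0; have e30 : 0 < e / 3 by exact: divr_gt0.
(* The bound for [h] is weak, so [e / 4] is used to get strictly below [e / 3]. *)
have e40 : 0 < e / 4 by exact: divr_gt0.
have [DX /(_ g Xg _ e30)[h Dh gh]] := dense.
have [r Hr] := compact_support_translate_small Dh e40.
have e43 : ((e / 4)%:E < (e / 3)%:E)%E by rewrite lte_fin; lra.
exists r => xi /Hr/le_lt_trans/(_ e43) hxi.
apply: le_lt_trans (bbfs_norm_translate_approx xi Xg (DX _ Dh)) _.
rewrite (_ : e = e / 3 + (e / 3 + e / 3)); last by lra.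
by rewrite !EFinD; apply: (lteD gh); exact: lteD hxi gh.
Qed.

Lemma totally_bounded_conditions F : F `<=` bbfs_space X -> bbfs_totally_bounded X F ->
  [/\ bbfs_bounded X F, uniformly_vanishes_at_infinity X F & uniformly_equicontinuous X F].
Proof.
move=> FX tb; split.
- have [G [finG GF net]] := tb 1 ltr01.
  have [S S0 GS] : exists2 S : R, 0 < S & forall g, G g -> (norm g <= S%:E)%E.
    apply: (finite_set_uniform_radius (P := fun g S => (norm g <= S%:E)%E)) => //.
      by move=> g r s rs /le_trans; apply; rewrite lee_fin.
    move=> g /GF/FX Xg; exists (fine (norm g)).
    by rewrite fineK// ge0_fin_numE ?bbfs_norm_ge0 ?bbfs_norm_fin.
  apply: (@le_lt_trans _ _ (1 + S)%:E); last exact: ltry.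
  apply: ge_ereal_sup => _ [f Ff <-]; have [g Gg fg] := net f Ff.
  have Xf := FX _ Ff; have Xg := FX _ (GF _ Gg).
  have -> : f = (f \- g) \+ g by apply/funext => x /=; rewrite subrK.
  apply: le_trans (bbfs_normD X (mX (bbfs_spaceB Xf Xg)) (mX Xg)) _.
  by rewrite EFinD; exact: leeD (ltW fg) (GS g Gg).
- move=> e e0; have e20 : 0 < e / 2 by exact: divr_gt0.
  have [G [finG GF net]] := tb _ e20.
  have [M M0 GM] : exists2 M : R, 0 < M & forall g, G g ->
      (bbfs_space X g -> norm (g \* \1_(tail_set M))%R < (e / 2)%:E)%E.
    (* Membership in [X] is part of the predicate because monotonicity in [M] relies on the
       measurability of [g]. *)
    apply: (finite_set_uniform_radius (P := fun g M =>
      bbfs_space X g -> (norm (g \* \1_(tail_set M))%R < (e / 2)%:E)%E)) => //.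
      move=> g r s rs gr Xg; apply: le_lt_trans (gr Xg).
      apply: (le_bbfs_norm X (mtail r Xg) (mtail s Xg)) => x /=; rewrite !normrM ler_wpM2l//.
      rewrite !indicE; case: (boolP (x \in tail_set s)) => [/set_mem xs|_]; last by rewrite normr0.
      by rewrite mem_set//; exact: le_lt_trans rs xs.
    by move=> g /GF/FX Xg; have [M HM] := bbfs_norm_tail_small Xg e20; exists M.
  exists M => // f Ff; have [g Gg fg] := net f Ff.
  have Xf := FX _ Ff; have Xg := FX _ (GF _ Gg).
  apply: le_lt_trans (bbfs_norm_tail_approx M Xf Xg) _.
  by rewrite [X in (_ < X%:E)%E]splitr EFinD; exact: lteD fg (GM g Gg Xg).
- move=> e e0; have e30 : 0 < e / 3 by exact: divr_gt0.
  have [G [finG GF net]] := tb _ e30.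
  have [r r0 Gr] : exists2 r : R, 0 < r & forall g, G g ->
      forall xi, euclidean_norm xi * r < 1 -> (norm (translate g xi \- g)%R < (e / 3)%:E)%E.
    apply: (finite_set_uniform_radius (P := fun g r => forall xi,
      euclidean_norm xi * r < 1 -> (norm (translate g xi \- g)%R < (e / 3)%:E)%E)) => //.
      move=> g r s rs gr xi xis; apply: gr; apply: le_lt_trans xis.
      by rewrite ler_wpM2l// sqrtr_ge0.
    by move=> g /GF/FX Xg; exact: bbfs_translate_small.
  (* [r] is an inverse radius, so its inverse is the radius of equicontinuity. *)
  exists r^-1; first by rewrite invr_gt0.
  move=> f xi Ff xir; have [g Gg fg] := net f Ff.
  have Xf := FX _ Ff; have Xg := FX _ (GF _ Gg).
  have gxi : (norm (translate g xi \- g)%R < (e / 3)%:E)%E.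
    by apply: Gr => //; rewrite -ltr_pdivlMr// mul1r.
  apply: le_lt_trans (bbfs_norm_translate_approx xi Xf Xg) _.
  rewrite (_ : e = e / 3 + (e / 3 + e / 3)); last by lra.
  by rewrite !EFinD; apply: (lteD fg); exact: lteD gxi fg.
Qed.

End necessity.

Theorem theorem3p6 (R : realType) (n : nat) (n_gt0 : (0 < n)%N)
    (X : ballBanachFunctionSpace R n) :
  (forall F : set ('rV[R]_n -> R), F `<=` bbfs_space X ->
     bbfs_bounded X F ->
     uniformly_vanishes_at_infinity X F ->
     uniformly_equicontinuous X F ->
     bbfs_totally_bounded X F) /\
  (bbfs_dense X continuous_compact_support ->
   translation_invariant X ->
   forall F : set ('rV[R]_n -> R), F `<=` bbfs_space X ->
     bbfs_totally_bounded X F ->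
     [/\ bbfs_bounded X F,
         uniformly_vanishes_at_infinity X F
       & uniformly_equicontinuous X F]).
Proof.
split=> [F FX|dense tinv F FX]; first exact: compactness_criterion.
exact: totally_bounded_conditions.
Qed.
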